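(* Let $n\in\mathbb{N}$ (with $n\ge 1$), and let $S=[a_1,a_2]\cup[a_3,a_4]\cup\ldots\cup[a_{2\ell-1},a_{2\ell}]$ with $\ell\ge 1$ and real numbers $a_1<a_2<\ldots<a_{2\ell}$ be a finite union of real intervals with $0\notin S$. Let $L_n(S)$ be the minimum deviation and $\kappa(S)=\lim_{k\to\infty}\sqrt[k]{L_k(S)}$ the estimated asymptotic convergence factor. Then $$L_n(S)\ \geq\ \frac{2\,\kappa(S)^n}{1+\kappa(S)^{2n}}.$$ Equality is attained in this inequality if and only if there exists a polynomial $P_n$ of degree exactly $n$ with complex coefficients such that $S=P_n^{-1}([-1,1])$. If, in addition to $S=P_n^{-1}([-1,1])$ for such a polynomial $P_n$ of degree $n$, the point $0$ lies in the convex hull of $S$, then $L_n(S)=L_{n+1}(S)$.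
   Context: $\mathbb{P}_n$ denotes the set of all polynomials of degree at most $n$ with complex coefficients. For a compact set $S\subset\mathbb{C}$ and a polynomial $P$, $\|P\|_S:=\max_{z\in S}|P(z)|$. For a compact infinite set $S\subset\mathbb{C}$ with $0\notin S$, the minimum deviation is $L_n(S):=\min\{\|P_n\|_S: P_n\in\mathbb{P}_n,\ P_n(0)=1\}$. The limit $\kappa(S):=\lim_{n\to\infty}\sqrt[n]{L_n(S)}$ exists and is called the estimated asymptotic convergence factor. For a polynomial $P_n$ of degree exactly $n$, $P_n^{-1}([-1,1]):=\{z\in\mathbb{C}: P_n(z)\in[-1,1]\}$ (the inverse image is taken in the whole complex plane). *)

(* Defs.v *)
From HB Require Import structures.
From mathcomp Require Import all_boot all_order all_algebra.
From mathcomp Require Import all_classical all_reals all_analysis.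
From mathcomp Require Import complex.

Set Implicit Arguments.
Unset Strict Implicit.
Unset Printing Implicit Defensive.

Import Order.TTheory GRing.Theory Num.Theory.
Import numFieldNormedType.Exports.

Local Open Scope classical_set_scope.
Local Open Scope ring_scope.
Local Open Scope complex_scope.

(* The maximum of |P| over S, written as a supremum: the two agree as soon as
   S is compact and nonempty. *)
Definition poly_norm (R : realType) (S : set R[i]) (P : {poly R[i]}) : R :=
  sup [set ComplexField.Normc.normc P.[z] | z in S].

(* [size P <= n.+1] means [deg P <= n].  The minimum is written as an infimum;
   it is attained when S is compact and infinite. *)
Definition min_dev (R : realType) (S : set R[i]) (n : nat) : R :=
  inf [set poly_norm S P | P in
         [set P : {poly R[i]} | (size P <= n.+1)%N /\ P.[0] = 1]].

(* The root of order k is the real power of exponent 1/k; the junk term at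
   k = 0 does not affect the limit. *)
Definition conv_factor (R : realType) (S : set R[i]) : R :=
  limn (fun k : nat => min_dev S k `^ k%:R^-1).

(* The i-th interval (counted from 0) joins entries 2i and 2i+1 of [a], which
   are the endpoints a_(2i+1) and a_(2i+2) when the endpoints are numbered
   from 1. *)
Definition interval_union (R : realType) (l : nat) (a : l.*2.-tuple R) :
    set R[i] :=
  \bigcup_(i in `I_l) (real_complex R @` `[a`_i.*2, a`_i.*2.+1]).

Definition inverse_image (R : realType) (P : {poly R[i]}) : set R[i] :=
  (fun z : R[i] => P.[z]) @^-1` (real_complex R @` `[-1, 1]).

(* [Rcomplex R] is R[i] seen as a vector space over R. *)
Definition convex_hull (R : realType) (S : set R[i]) : set R[i] :=
  smallest (@convex_set R (Rcomplex R)) S.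

(* Main.v *)
(* Only the polynomial T_2 = 2 X^2 - 1 is needed: if L_n < 1, write
   L_n = 2u/(1+u^2); T_2 maps 1/L_n = (u + 1/u)/2 to the same expression in u^2.
   If q is a minimizer of degree n, iterating T_2 on p = q/L_n gives admissible
   polynomials of degree n 2^j of norm at most 2 u^(2^j), so that kappa^n <= u
   because kappa is the infimum of the roots of the L_k (Fekete).

   If S = p^-1([-1,1]), Laguerre's inequality shows that the critical values of p
   lie outside ]-1,1[, hence p oscillates n times between -1 and 1 on S; counting
   the zeros of p - c q, for a better competitor q and c = p(0)/q(0), shows that
   p/p(0) is extremal.  The same holds for all the
   iterates T_2^j(p), which have the same preimage, and equality follows.

   Conversely equality makes all the iterates F of T_2 on p = q/L_n extremal.
   If d > 0 on S is a quadratic factor of F, then F - eps (F/d) X^2 has the same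
   value at 0 and a smaller norm on S (for d = 1 this shows that deg p = n).  So F
   has no nonreal zero and no two zeros in the same gap of S.  As the zeros of the
   iterates are dense in p^-1([-1,1]), this set is contained in S. *)
Require Import Defs.
From HB Require Import structures.
From mathcomp Require Import all_boot all_order all_algebra.
From mathcomp Require Import all_classical all_reals all_analysis.
From mathcomp Require Import complex polyrcf.
From mathcomp Require Import ring lra.

Set Implicit Arguments.
Unset Strict Implicit.
Unset Printing Implicit Defensive.

Import Order.TTheory GRing.Theory Num.Theory.
Import numFieldNormedType.Exports.

Local Open Scope classical_set_scope.
Local Open Scope ring_scope.
Local Open Scope complex_scope.

(** * Polynomials whose preimage of [-1,1] is real *)

Section RealRooted.
Variable R : realType.
Implicit Types (p q : {poly R}) (x y z r : R) (rs : seq R).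

Local Notation toC p := (map_poly (real_complex R) p).

(** The points [z] are complex: for each [c] in [-1,1] every complex root of [p - c] is then real,
    which is what Laguerre's inequality needs. *)
Definition real_preimage p :=
  forall z : R[i], inverse_image (toC p) z -> complex.Im z = 0.

Lemma deriv_XsubCM p r :
  (('X - r%:P) * p)^`() = p + ('X - r%:P) * p^`().
Proof. by rewrite derivM derivXsubC mul1r. Qed.

(** Induction on the roots: for p = (X - r) q one has p'^2 - p p'' = q^2 + (X - r)^2 (q'^2 - q
    q''). *)
Lemma laguerre_le rs x (p := \prod_(r <- rs) ('X - r%:P)) :
  p.[x] * p^`()^`().[x] <= p^`().[x] ^+ 2.
Proof.
rewrite {}/p; elim: rs => [|r rs IH].
  by rewrite big_nil !derivC !hornerE expr0n.
rewrite big_cons; move: IH; set q := \prod_(_ <- _) _ => IH.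
rewrite deriv_XsubCM derivD deriv_XsubCM !(hornerXsubC, hornerM, hornerD).
have h1 : 0 <= (x - r) ^+ 2 * (q^`().[x] ^+ 2 - q.[x] * q^`()^`().[x]).
  by rewrite mulr_ge0 ?sqr_ge0 ?subr_ge0.
have := sqr_ge0 q.[x].
nra.
Qed.

(** Splitting off one root leaves the term q^2, positive at [x]; the other term is handled by
    [laguerre_le]. *)
Lemma laguerre_lt rs x (p := \prod_(r <- rs) ('X - r%:P)) :
  (0 < size rs)%N -> p.[x] != 0 -> p.[x] * p^`()^`().[x] < p^`().[x] ^+ 2.
Proof.
rewrite {}/p; case: rs => // r rs _; rewrite big_cons.
have := laguerre_le rs x; set q := \prod_(_ <- _) _ => IH.
rewrite deriv_XsubCM derivD deriv_XsubCM !(hornerXsubC, hornerM, hornerD).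
rewrite mulf_eq0 negb_or.
move=> /andP[_ q0].
have h1 : 0 <= (x - r) ^+ 2 * (q^`().[x] ^+ 2 - q.[x] * q^`()^`().[x]).
  by rewrite mulr_ge0 ?sqr_ge0 ?subr_ge0.
have h2 : 0 < q.[x] ^+ 2 by rewrite exprn_even_gt0.
nra.
Qed.

Lemma split_of_real_roots p :
  (forall z : R[i], root (toC p) z -> complex.Im z = 0) ->
  exists rs, p = lead_coef p *: \prod_(r <- rs) ('X - r%:P).
Proof.
move=> Hr; have [rs Dp] := closed_field_poly_normal (toC p).
exists (map (@complex.Re R) rs).
have [->|p0] := eqVneq p 0; first by rewrite lead_coef0 scale0r.
have l0 : lead_coef (toC p) != 0 by rewrite lead_coef_eq0 map_poly_eq0.
apply: (@map_poly_inj _ _ (real_complex R)).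
rewrite /= [LHS]Dp map_polyZ lead_coef_map; congr (_ *: _).
rewrite rmorph_prod big_map !big_seq.
apply: eq_bigr => z zrs /=; rewrite rmorphB /= map_polyX map_polyC /=.
congr ('X - _%:P); have : root (toC p) z.
  by rewrite Dp rootZ // root_prod_XsubC.
by move/Hr; case: z {zrs} => a b /= ->.
Qed.

(* Laguerre's inequality for [p - 1] and [p + 1] would give opposite signs to
   the second derivative. *)
Lemma critical_value_ge1 p x :
  real_preimage p -> (1 < size p)%N ->
  p^`().[x] = 0 -> 1 <= `|p.[x]|.
Proof.
move=> Hp sp p'x; rewrite leNgt; apply/negP => px1.
(* [p - w] splits over the reals and p' vanishes at [x], so Laguerre's inequality reduces to (p - w)
   p'' < 0 there. *)
have key w : -1 <= w <= 1 -> p.[x] - w != 0 -> (p.[x] - w) * p^`()^`().[x] < 0.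
  move=> hw wx; pose q := p - w%:P.
  have sq : size q = size p.
    by rewrite size_polyDl // size_polyN; apply: leq_ltn_trans (size_polyC_leq1 _) sp.
  have [rs Dq] : exists rs, q = lead_coef q *: \prod_(r <- rs) ('X - r%:P).
    apply: split_of_real_roots => z; rewrite rootE rmorphB /= map_polyC /= !hornerE.
    rewrite subr_eq0 => /eqP hz; apply: Hp; exists w => //=.
  have lq : lead_coef q != 0 by rewrite lead_coef_eq0 -size_poly_eq0 sq; case: size sp.
  have srs : (0 < size rs)%N.
    move: sp; rewrite -sq Dq size_scale // size_prod_XsubC ltnS //.
  have qx : q.[x] = p.[x] - w by rewrite !hornerE.
  have q'x : q^`() = p^`() by rewrite derivB derivC subr0.
  have := @laguerre_lt rs x srs.
  move: wx (p'x); rewrite -qx -q'x Dq !derivZ !hornerE mulf_eq0 negb_or.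
  move=> /andP[_ h1] /eqP; rewrite mulf_eq0 (negPf lq) => /eqP h2 /(_ h1).
  rewrite h2 expr0n /= => h3.
  have : 0 < lead_coef q ^+ 2 by rewrite exprn_even_gt0.
  nra.
have /andP[h1 h2] : -1 < p.[x] < 1 by rewrite -ltr_norml.
have k1 : (p.[x] - 1) * p^`()^`().[x] < 0.
  by apply: key; [lra | rewrite ltr0_neq0 // subr_lt0].
have k2 : (p.[x] - -1) * p^`()^`().[x] < 0.
  by apply: key; [lra | rewrite lt0r_neq0 // subr_gt0].
have : p^`()^`().[x] < 0 by rewrite -(pmulr_rlt0 _ (_ : 0 < p.[x] - -1)) // subr_gt0.
have : 0 < p^`()^`().[x] by rewrite -(nmulr_rlt0 _ (_ : p.[x] - 1 < 0)) // subr_lt0.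
lra.
Qed.

Lemma uniq_roots_of_deriv rs :
  {in rs, forall x, (\prod_(r <- rs) ('X - r%:P))^`().[x] != 0} -> uniq rs.
Proof.
elim: rs => // r rs IH; rewrite big_cons; set q := \prod_(_ <- _) _.
have qE x : x \in rs -> q.[x] = 0 by move=> xrs; apply/rootP; rewrite root_prod_XsubC.
move=> H; rewrite /= IH ?andbT => [|x xrs].
  apply/negP => rrs; have := H r (mem_head _ _).
  by rewrite derivM derivXsubC !hornerE qE // subrr mul0r addr0 eqxx.
have := H x; rewrite inE xrs orbT derivM derivXsubC !hornerE qE // add0r.
by move=> /(_ isT); rewrite mulf_eq0 negb_or => /andP[].
Qed.

(** The value at a zero has modulus less than 1, so no zero is critical by [critical_value_ge1]: all
    zeros are simple. *)
Lemma uniq_real_roots p :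
  real_preimage p -> (1 < size p)%N ->
  exists rs, [/\ uniq rs, (size p = (size rs).+1)%N & all (root p) rs].
Proof.
move=> Hp sp.
have [|rs Dp] := @split_of_real_roots p.
  move=> z /rootP pz; apply: Hp; rewrite /inverse_image /preimage /= pz.
  by exists 0 => //=; rewrite in_itv /=; lra.
have lp : lead_coef p != 0 by rewrite lead_coef_eq0 -size_poly_eq0; case: size sp.
exists rs; split; last 2 first.
- by rewrite Dp size_scale // size_prod_XsubC.
- by apply/allP => x xrs; rewrite Dp rootZ // root_prod_XsubC.
apply: uniq_roots_of_deriv => x xrs; apply/negP => /eqP q'x.
have /rootP px : root p x by rewrite Dp rootZ // root_prod_XsubC.
have := @critical_value_ge1 p x Hp sp.
by rewrite px normr0 {1}Dp derivZ hornerZ q'x mulr0 ler10 => /(_ erefl).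
Qed.

(** Applied to [p ^+ 2 - 1], this locates the ends of the bands, where [|p| < 1], and of the gaps,
    where [|p| > 1]. *)
Lemma first_root p x b : x < b -> p.[x] != 0 -> p.[x] * p.[b] <= 0 ->
  exists y, [/\ x < y, p.[y] = 0 & forall z, x <= z < y -> 0 < p.[x] * p.[z]].
Proof.
move=> xb px pxb.
have sgn y : {in `]x, y[, forall z, ~~ root p z} ->
    forall z, x <= z < y -> 0 < p.[x] * p.[z].
  move=> hy z /andP[xz zy]; rewrite ltNge; apply/negP => /(polyrcf.poly_ivt xz)[w].
  rewrite in_itv /= => /andP[xw wz]; apply/negP.
  have [<-|xw'] := eqVneq x w; first by rewrite rootE.
  by apply: hy; rewrite in_itv /= lt_neqAle xw' xw (le_lt_trans wz).
case: (next_rootP p x b) => [p0|y p0 py|c p0 _ hp].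
- by move: px; rewrite p0 hornerC eqxx.
- rewrite in_itv /= => /andP[xy yb] hp; exists y; split => //; exact: sgn.
(* No zero lies in []x, b[], so the sign condition forces one at [b]. *)
have pb : p.[b] = 0.
  apply/eqP/negPn/negP => pb.
  have /(poly_ivtoo (ltW xb))[z zi] : p.[x] * p.[b] < 0.
    by rewrite lt_neqAle pxb mulf_neq0.
  by apply/negP/hp.
by exists b; split => //; exact: sgn.
Qed.

(** This is [first_root] for the reflected polynomial [p \Po (- 'X)]. *)
Lemma last_root p a x : a < x -> p.[x] != 0 -> p.[x] * p.[a] <= 0 ->
  exists y, [/\ y < x, p.[y] = 0 & forall z, y < z <= x -> 0 < p.[x] * p.[z]].
Proof.
move=> ax px pax.
have E z : (p \Po (- 'X)).[z] = p.[- z] by rewrite horner_comp !hornerE.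
have [|||y [xy py H]] := @first_root (p \Po (- 'X)) (- x) (- a).
- by rewrite ltrN2.
- by rewrite E opprK.
- by rewrite !E !opprK.
exists (- y); split; [by rewrite ltrNl|by rewrite -E|] => z /andP[yz zx].
by have := H (- z); rewrite !E !opprK; apply; rewrite lerN2 ltrNl zx yz.
Qed.

(* Equal values at both ends would give a critical value of modulus less than 1
   by Rolle. *)
Lemma band_of_root p B r :
  real_preimage p -> (1 < size p)%N ->
  (forall x, `|p.[x]| <= 1 -> `|x| <= B) -> root p r ->
  exists a b, [/\ a < r < b, `|p.[a]| = 1, `|p.[b]| = 1, p.[a] * p.[b] < 0 &
     forall x, a < x < b -> `|p.[x]| < 1].
Proof.
(* [g] is negative exactly where [|p| < 1]. The ends of the band are its nearest zeros on either
   side of [r]; they exist because [|p| > 1] beyond [B]. *)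
move=> Hp sp HB /rootP pr; pose g := p ^+ 2 - 1.
have gE x : g.[x] = `|p.[x]| ^+ 2 - 1 by rewrite !hornerE real_normK ?num_real.
have g0 x : g.[x] = 0 -> `|p.[x]| = 1.
  rewrite gE => /eqP; rewrite subr_eq0 sqrp_eq1 ?normr_ge0 // => /eqP //.
have gr : g.[r] = -1 by rewrite gE pr normr0; lra.
have out x : B < `|x| -> g.[r] * g.[x] <= 0.
  move=> Bx; rewrite gr gE mulN1r oppr_le0 subr_ge0.
  have : 1 < `|p.[x]| by rewrite ltNge; apply/negP => /HB; rewrite leNgt Bx.
  by move=> h; rewrite exprn_ege1 // ltW.
have neg x : 0 < g.[r] * g.[x] -> `|p.[x]| < 1.
  rewrite gr gE mulN1r oppr_gt0 subr_lt0; rewrite expr_lt1 //.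
have gr0 : g.[r] != 0 by rewrite gr; lra.
have rB : `|r| <= B by apply: HB; rewrite pr normr0.
have B0 : 0 <= B by apply: le_trans rB.
have [||b [rb gb Hb]] := @first_root g r (B + 1) _ gr0.
- by move: rB; rewrite ler_norml; lra.
- by apply: out; rewrite ger0_norm; lra.
have [||a [ar ga Ha]] := @last_root g (- (B + 1)) r _ gr0.
- by move: rB; rewrite ler_norml; lra.
- by apply: out; rewrite normrN ger0_norm; lra.
have lt1 x : a < x < b -> `|p.[x]| < 1.
  move=> /andP[ax xb]; apply: neg; have [rx|xr] := leP r x.
    by apply: Hb; rewrite rx.
  by apply: Ha; rewrite ax ltW.
exists a, b; split => //; [by rewrite ar|exact: g0|exact: g0|].
rewrite lt_neqAle; apply/andP; split; first by rewrite mulf_neq0 // -normr_eq0 g0 ?oner_eq0.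
rewrite leNgt; apply/negP => pab.
have pE : p.[a] = p.[b].
  have : `|p.[a]| == `|p.[b]| by rewrite !g0.
  rewrite eqr_norm2 => /orP[/eqP //|/eqP pE]; exfalso; move: pab.
  by rewrite pE mulNr oppr_gt0 -expr2 -real_normK ?num_real // g0 // expr1n ltr10.
have [x] := poly_rolle (lt_trans ar rb) pE.
rewrite in_itv /= => xab p'x.
by have := critical_value_ge1 Hp sp p'x; rewrite leNgt lt1.
Qed.


(** * Zeros of [p - q] for a competitor [q] that beats [p] *)

Section Extremal.
Variables (p q : {poly R}) (B : R).
Hypotheses (Hp : real_preimage p) (sp : (1 < size p)%N).
Hypothesis HB : forall x, `|p.[x]| <= 1 -> `|x| <= B.
Hypotheses (p0 : 1 < `|p.[0]|) (q0 : q.[0] = p.[0]).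
Hypothesis q1 : forall x, `|p.[x]| <= 1 -> `|q.[x]| < 1.

(** At the ends of a band [p] dominates [q], so [p - q] has the sign of [p] there and changes sign
    across the band. *)
Lemma diff_sign x : `|p.[x]| = 1 -> 0 < p.[x] * (p.[x] - q.[x]).
Proof.
move=> px; have := @q1 x; rewrite px lexx => /(_ isT).
rewrite mulrBr -expr2 -real_normK ?num_real // px expr1n subr_gt0 => qx.
by apply: le_lt_trans (ler_norm _) _; rewrite normrM px mul1r.
Qed.

(* [p - q] vanishes at 0, and once in the band around each zero of [p]. *)
Lemma extremal_quotient : exists d,
  [/\ p - q = 'X * d, d != 0 & exists zs,
   [/\ uniq zs, (size p = (size zs).+1)%N & forall z, z \in zs -> d.[z] = 0 /\ `|p.[z]| < 1]].
Proof.
have /factor_theorem[d Dd] : root (p - q) 0 by rewrite rootE !hornerE q0 subrr.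
have {}Dd : p - q = 'X * d by rewrite Dd subr0 mulrC.
have dE x : p.[x] - q.[x] = x * d.[x].
  by have := congr1 (fun u => u.[x]) Dd; rewrite /= !hornerE.
(* The implication stays under the existential so that [choice] yields a total function; [(0, 0)] is
   a dummy value. *)
have band r : exists ab, root p r -> [/\ ab.1 < r < ab.2,
    `|p.[ab.1]| = 1, `|p.[ab.2]| = 1, p.[ab.1] * p.[ab.2] < 0 &
     forall x, ab.1 < x < ab.2 -> `|p.[x]| < 1].
  have [/(band_of_root Hp sp HB)[a [b H]]|nr] := boolP (root p r).
    by exists (a, b).
  by exists (0, 0).
have {band} [ab Hab] := choice band.
have zero r : exists z, root p r -> (ab r).1 < z < (ab r).2 /\ d.[z] = 0.
  have [/Hab[/andP[ar rb] pa pb pab H]|nr] := boolP (root p r); last by exists 0.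
  have [|z] := @poly_ivtoo _ (p - q) (ab r).1 (ab r).2 (ltW (lt_trans ar rb)).
    rewrite !hornerE -(nmulr_rgt0 _ pab) mulrACA.
    by rewrite mulr_gt0 ?diff_sign.
  rewrite in_itv /= rootE !hornerE dE => zab /eqP dz.
  (* The zero of ['X * d] is not 0, since [|p| < 1] in the band and [|p.[0]| > 1]; so it is a zero
     of [d]. *)
  exists z => _; split=> //; move/eqP: dz; rewrite mulf_eq0 => /orP[|/eqP//].
  by move=> /eqP z0; move: (H _ zab); rewrite z0 ltNge ltW.
have {zero} [f Hf] := choice zero.
have [rs [urs srs /allP rrs]] := uniq_real_roots Hp sp.
exists d; split => //.
  apply/eqP => d0; have [x px] : exists x, root p x.
    case: rs srs rrs {urs} => [|x rs] srs H; first by move: sp; rewrite srs.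
    by exists x; apply/H/mem_head.
  have [_ pa _ _ _] := Hab _ px; have := diff_sign pa.
  by rewrite dE d0 hornerC mulr0 mulr0 ltxx.
exists (map f rs); split; last 2 first.
- by rewrite size_map.
- move=> z /mapP[r /rrs pr ->]; have [_ _ _ _ H] := Hab _ pr.
  by have [/H] := Hf _ pr.
(* Between two zeros of [p] Rolle gives a critical point, which lies in neither band as [|p| >= 1]
   there. A common value of [f] would put it in one of them. *)
have key r s : root p r -> root p s -> r < s -> f r <> f s.
  move=> pr ps rs_lt fE; have [x] := @poly_rolle _ r s p rs_lt
    (etrans (rootP pr) (esym (rootP ps))).
  rewrite in_itv /= => /andP[rx xs] /(critical_value_ge1 Hp sp).
  have [/andP[ar _] _ _ _ Hr] := Hab _ pr; have [/andP[_ sb] _ _ _ Hs] := Hab _ ps.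
  have [/andP[_ h1] _] := Hf _ pr; have [/andP[h2 _] _] := Hf _ ps.
  rewrite leNgt; have [xf|fx] := ltP x (f r).
    by rewrite Hr // (lt_trans ar rx) (lt_trans xf).
  by rewrite Hs // (lt_trans xs) // andbT (lt_le_trans h2) // -fE.
rewrite map_inj_in_uniq // => r s /rrs pr /rrs ps fE.
have [rs_lt|sr_lt|//] := ltgtP r s; first by case: (key _ _ pr ps rs_lt).
by case: (key _ _ ps pr sr_lt).
Qed.

(** Otherwise [p - q = 'X * d] has degree at most deg p, although [d] alone has deg p distinct
    zeros. *)
Lemma extremal_degree : (size p < size q)%N.
Proof.
rewrite ltnNge; apply/negP => sqp.
have [d [Dd d0 [zs [uzs szs Hzs]]]] := extremal_quotient.
have /(max_poly_roots d0) : all (root d) zs by apply/allP => z /Hzs[/rootP].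
move=> /(_ uzs); rewrite -[(size zs < _)%N]ltnS -szs -(size_mulX d0) mulrC -Dd ltnNge.
by rewrite (leq_trans (size_polyD _ _)) // size_polyN geq_max leqnn.
Qed.

(* On the gap of [{x | `|p x| <= 1}] around 0 the quotient [(p - q) / X] has one
   more zero. *)
Lemma extremal_degree_hull s t : s < 0 < t -> `|p.[s]| <= 1 -> `|p.[t]| <= 1 ->
  ((size p).+1 < size q)%N.
Proof.
move=> /andP[s0 t0] ps pt; rewrite ltnNge; apply/negP => sqp.
have [d [Dd d0 [zs [uzs szs Hzs]]]] := extremal_quotient.
have dE x : p.[x] - q.[x] = x * d.[x].
  by have := congr1 (fun u => u.[x]) Dd; rewrite /= !hornerE.
pose g := p ^+ 2 - 1.
have gE x : g.[x] = `|p.[x]| ^+ 2 - 1 by rewrite !hornerE real_normK ?num_real.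
have g0 : 0 < g.[0] by rewrite gE subr_gt0 exprn_egt1.
have gz x : g.[x] = 0 -> `|p.[x]| = 1.
  by rewrite gE => /eqP; rewrite subr_eq0 sqrp_eq1 ?normr_ge0 // => /eqP.
have gpos x : 0 < g.[0] * g.[x] -> 1 < `|p.[x]|.
  by rewrite pmulr_rgt0 // gE subr_gt0 -[X in X < _](expr1n _ 2) ltr_pXn2r ?nnegrE.
have gneg x : `|p.[x]| <= 1 -> g.[0] * g.[x] <= 0.
  by move=> px; rewrite pmulr_rle0 // gE subr_le0 expr_le1.
(* []b, a[] is the gap around 0, with [b < 0 < a]. As [|p| > 1] inside, [p] has the same sign at
   both ends. *)
have [b [b0 /gz pb Hb]] := last_root s0 (lt0r_neq0 g0) (gneg _ ps).
have [a [a0 /gz pa Ha]] := first_root t0 (lt0r_neq0 g0) (gneg _ pt).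
have H x : b < x < a -> 1 < `|p.[x]|.
  move=> /andP[bx xa]; apply: gpos; have [x0|x0] := leP x 0.
    by apply: Hb; rewrite bx.
  by apply: Ha; rewrite ltW.
have pab : 0 < p.[a] * p.[b].
  rewrite ltNge mulrC; apply/negP => /(polyrcf.poly_ivt (ltW (lt_trans b0 a0)))[x].
  rewrite in_itv /= => /andP[bx xa] /rootP px.
  have : b < x < a.
    rewrite !lt_neqAle bx xa !andbT; apply/andP; split; apply/eqP => xE.
      by move: pb; rewrite xE px normr0 => /esym/eqP; rewrite oner_eq0.
    by move: pa; rewrite -xE px normr0 => /esym/eqP; rewrite oner_eq0.
  by move/H; rewrite px normr0 ltr10.
(* By [diff_sign] the product [x * d.[x]] has the same sign at [b] and [a], while [x] changes sign;
   so [d] does too. Its new zero is not in [zs], where [|p| < 1]. *)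
have [|y] := @poly_ivtoo _ d b a (ltW (lt_trans b0 a0)).
  rewrite -(nmulr_rgt0 _ (_ : b * a < 0)) ?nmulr_rlt0 // -(pmulr_rgt0 _ pab).
  have := mulr_gt0 (diff_sign pa) (diff_sign pb); rewrite !dE.
  by congr (0 < _); ring.
rewrite in_itv /= => yab dy.
have ynzs : y \notin zs by apply/negP => /Hzs[_]; rewrite ltNge ltW // H.
have /(max_poly_roots d0) : all (root d) (y :: zs).
  by rewrite /= dy; apply/allP => z /Hzs[/rootP].
rewrite /= ynzs uzs => /(_ isT); rewrite -ltnS -szs -(size_mulX d0) mulrC -Dd ltnNge.
by rewrite (leq_trans (size_polyD _ _)) // size_polyN geq_max leqnSn.
Qed.

End Extremal.

End RealRooted.

(** * Roots of submultiplicative sequences *)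

Section Fekete.
Variables (R : realType) (L : nat -> R).
Hypotheses (L0 : forall k, 0 <= L k) (L1 : forall k, L k <= 1).
Hypothesis LM : forall m k, L (m + k) <= L m * L k.
Implicit Types (x y c : R).

Local Notation rootL := (fun k : nat => L k `^ k%:R^-1).

Lemma powR_invK k x : (0 < k)%N -> 0 <= x -> (x `^ k%:R^-1) ^+ k = x.
Proof.
move=> k0 x0; rewrite -powR_mulrn ?powR_ge0 // -powRrM mulVf ?powRr1 //.
by rewrite pnatr_eq0 -lt0n.
Qed.

(** If x / y = 1 + e with e > 0, then (1 + e)^k > k e exceeds [c] for large [k]. Asking only for
    arbitrarily large [k] lets the powers of two suffice. *)
Lemma le_of_exp_bound x y c : 0 <= x -> 0 < y ->
  (forall m, exists2 k, (m <= k)%N & x ^+ k <= c * y ^+ k) -> x <= y.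
Proof.
move=> x0 y0 H; rewrite leNgt; apply/negP => yx.
pose e := x / y - 1; have e0 : 0 < e by rewrite subr_gt0 ltr_pdivlMr // mul1r.
have xE : x / y = 1 + e by rewrite /e; lra.
have [k] := H (Num.truncn (c / e)).+1.
move=> mk; rewrite -ler_pdivrMr ?exprn_gt0 // -expr_div_n xE leNgt => /negP; apply.
have ce : c < k%:R * e.
  rewrite -ltr_pdivrMr //; apply: lt_le_trans (truncnS_gt _) _.
  by rewrite ler_nat.
apply: lt_le_trans ce _; rewrite mulr_natl; elim: k {mk} => [|k IH].
  by rewrite expr0 mulr0n.
rewrite exprS mulrSr mulrDl mul1r lerD //.
by rewrite ler_peMr ?(ltW e0) // exprn_ege1 // lerDl ltW.
Qed.

Lemma submul_iter m q : L (m * q) <= L m ^+ q.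
Proof.
elim: q => [|q IH]; first by rewrite muln0 expr0.
by rewrite mulnS exprS (le_trans (LM _ _)) // ler_wpM2l.
Qed.

Lemma root_le1 k : rootL k <= 1.
Proof.
have [->|k0] := posnP k; first by rewrite invr0 powRr0.
by rewrite -(@expr_le1 _ k) ?powR_ge0 // powR_invK.
Qed.

Let kappa := inf [set L k `^ k%:R^-1 | k in [set k | (0 < k)%N]].

Lemma inf_root_le k : (0 < k)%N -> kappa <= rootL k.
Proof.
move=> k0; apply: ge_inf; last by exists k.
by exists 0 => _ [j _ <-]; exact: powR_ge0.
Qed.

Lemma inf_root_ge0 : 0 <= kappa.
Proof.
apply: lb_le_inf; first by exists (L 1 `^ 1%:R^-1), 1%N.
by move=> _ [j _ <-]; exact: powR_ge0.
Qed.

Lemma inf_root_near e : kappa < e -> exists N, forall k, (N <= k)%N -> rootL k <= e.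
Proof.
move=> ke; have [m m0 me] : exists2 m, (0 < m)%N & rootL m < e.
  have [|_ [m m0 <-] me] := @inf_lt _ [set L k `^ k%:R^-1 | k in [set k | (0 < k)%N]] e _ ke.
    by exists (L 1 `^ 1%:R^-1), 1%N.
  by exists m.
have [e1|e1] := leP 1 e; first by exists 0%N => k _; exact: le_trans (root_le1 _) e1.
(* The maximum with [e / 2] keeps [d] positive, so that its powers can be inverted. *)
pose d := (Num.max (rootL m) (e / 2)).
have e0 : 0 < e := le_lt_trans (powR_ge0 _ _) me.
have de : d < e by rewrite /d gt_max me; lra.
have d0 : 0 < d by rewrite /d lt_max; apply/orP; right; lra.
have d1 : d <= 1 by rewrite ltW // (lt_trans de).
have Lm : L m <= d ^+ m.
  by rewrite -{1}(powR_invK m0 (L0 m)) lerXn2r ?nnegrE ?powR_ge0 ?(ltW d0) // /d le_max lexx.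
(* Fekete's division: [k] is a multiple of [m] plus a remainder whose factor is at most 1; rounding
   [k] down costs at most [d ^- m]. *)
have Lk k : L k <= (d ^+ m)^-1 * d ^+ k.
  rewrite {1}(divn_eq k m) (le_trans (LM _ _)) // mulnC.
  apply: (@le_trans _ _ ((d ^+ m) ^+ (k %/ m) * 1)).
    rewrite ler_pM // (le_trans (submul_iter _ _)) // lerXn2r ?nnegrE //.
    by rewrite exprn_ge0 // ltW.
  rewrite mulr1 -exprM ler_pdivlMl ?exprn_gt0 // -exprD.
  have km := ltnW (ltn_ceil k m0).
  by rewrite ler_wiXn2l ?(ltW d0) // -mulnS mulnC.
apply/not_existsP => H.
(* If no [N] works, then e^k is at most a constant times d^k for arbitrarily large [k]. *)
suff : e <= d by rewrite leNgt de.
apply: (@le_of_exp_bound _ _ (d ^+ m)^-1) => // [|N]; first exact: ltW.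
have /existsNP[k /not_implyP[Nk /negP]] := H (maxn N 1).
rewrite -ltNge => ek; exists k; first exact: leq_trans (leq_maxl _ _) Nk.
apply: le_trans (Lk k); rewrite -(@powR_invK k (L k)) //; last first.
  exact: leq_trans (leq_maxr _ _) Nk.
by rewrite lerXn2r ?nnegrE ?powR_ge0 ?ltW.
Qed.

Lemma root_cvg : rootL @ \oo --> kappa.
Proof.
apply/cvgrPdist_le => /= e e0; have [|N HN] := @inf_root_near (kappa + e).
  by rewrite ltrDl.
exists (maxn N 1) => // k /= Nk; rewrite distrC ger0_norm ?subr_ge0.
  by rewrite lerBlDl HN // (leq_trans (leq_maxl _ _) Nk).
by rewrite inf_root_le // (leq_trans (leq_maxr _ _) Nk).
Qed.

Lemma lim_rootE : limn rootL = kappa.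
Proof. exact/cvg_lim/root_cvg. Qed.

Lemma lim_root_ge0 : 0 <= limn rootL.
Proof. by rewrite lim_rootE inf_root_ge0. Qed.

Lemma lim_root_exp_le k : (0 < k)%N -> limn rootL ^+ k <= L k.
Proof.
move=> k0; rewrite lim_rootE -[leRHS](powR_invK k0 (L0 k)).
by rewrite lerXn2r ?nnegrE ?inf_root_le ?inf_root_ge0 ?powR_ge0.
Qed.

(** Otherwise some [e] strictly between the limit and the [n]-th root of [u] bounds the roots
    eventually, so that L (n k) < u^k for all large [k]. *)
Lemma lim_root_exp_ge n u : (0 < n)%N -> 0 <= u ->
  (forall m, exists2 k, (m <= k)%N & u ^+ k <= L (n * k)) -> u <= limn rootL ^+ n.
Proof.
move=> n0 u0 H; rewrite lim_rootE -{1}(powR_invK n0 u0).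
rewrite lerXn2r ?nnegrE ?inf_root_ge0 ?powR_ge0 // leNgt; apply/negP => ku.
have [h1 h2] := midf_lt ku; set e := (_ / 2) in h1 h2.
have [N HN] := inf_root_near h1.
have [k Nk] := H (maxn N 1); rewrite leNgt => /negP; apply.
have nk0 : (0 < n * k)%N by rewrite muln_gt0 n0 (leq_trans (leq_maxr _ _) Nk).
rewrite -(powR_invK nk0 (L0 _)) -[in ltRHS](powR_invK n0 u0) -exprM.
rewrite ltr_pXn2r ?nnegrE ?powR_ge0 //.
apply: le_lt_trans (HN _ _) h2; apply: leq_trans (leq_pmull k n0).
exact: leq_trans (leq_maxl _ _) Nk.
Qed.

End Fekete.

(** * Attainment of the minimum deviation *)

Section MinDev.
Variable R : realType.
Implicit Types (A : set R) (p q : {poly R}) (M x y : R) (n : nat).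

Local Notation toC p := (map_poly (real_complex R) p).
Local Notation normc := ComplexField.Normc.normc.

(** Only real polynomials enter, and [M] is a bound rather than the norm itself, so suprema and
    complex coefficients can be left behind. *)
Definition admissible A n M := exists q : {poly R},
  [/\ (size q <= n.+1)%N, q.[0] = 1 & forall x, A x -> `|q.[x]| <= M].

Lemma normc_real x : normc x%:C = `|x|.
Proof. by rewrite /= expr0n /= addr0 sqrtr_sqr. Qed.

Lemma normc_ge0 (z : R[i]) : 0 <= normc z.
Proof. by case: z => a b; exact: sqrtr_ge0. Qed.

Lemma normRe_le_normc (z : R[i]) : `|complex.Re z| <= normc z.
Proof.
case: z => a b /=; rewrite -(ler_pXn2r (ltn0Sn 1)) ?nnegrE ?sqrtr_ge0 //.
by rewrite sqr_sqrtr ?addr_ge0 ?sqr_ge0 // real_normK ?num_real // lerDl sqr_ge0.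
Qed.

Lemma normIm_le_normc (z : R[i]) : `|complex.Im z| <= normc z.
Proof.
case: z => a b /=; rewrite -(ler_pXn2r (ltn0Sn 1)) ?nnegrE ?sqrtr_ge0 //.
by rewrite sqr_sqrtr ?addr_ge0 ?sqr_ge0 // real_normK ?num_real // lerDr sqr_ge0.
Qed.

Lemma normc_le_ReIm (z : R[i]) : normc z <= `|complex.Re z| + `|complex.Im z|.
Proof.
case: z => a b /=; rewrite -(ler_pXn2r (ltn0Sn 1)) ?nnegrE ?sqrtr_ge0 ?addr_ge0 //.
rewrite sqr_sqrtr ?addr_ge0 ?sqr_ge0 // sqrrD !real_normK ?num_real //.
by rewrite -addrA lerD2l lerDr mulrn_wge0 // mulr_ge0.
Qed.

Definition poly_Re (P : {poly R[i]}) : {poly R} := map_poly (@complex.Re R) P.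
Definition poly_Im (P : {poly R[i]}) : {poly R} := map_poly (@complex.Im R) P.

Lemma horner_ReIm (P : {poly R[i]}) x :
  P.[x%:C] = (poly_Re P).[x] +i* (poly_Im P).[x].
Proof.
have E : P = toC (poly_Re P) + 'i%C *: toC (poly_Im P).
  by apply/polyP => i; rewrite coefD coefZ !coef_map_id0 //=; exact: complexE.
rewrite {1}E hornerD hornerZ !horner_map /=.
by simpc.
Qed.

Lemma poly_bounded p (B : R) : exists C, forall x, `|x| <= B -> `|p.[x]| <= C.
Proof.
have [C HC] := poly_itv_bound p (- B) B.
by exists C => x; rewrite ler_norml => /HC.
Qed.

Section Bounded.
Variables (A : set R) (B : R).
Hypothesis A0 : A !=set0.
Hypothesis A_bnd : forall x, A x -> `|x| <= B.

Lemma has_sup_norm (P : {poly R[i]}) :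
  has_sup [set normc P.[z] | z in real_complex R @` A].
Proof.
have [x Ax] := A0; split; first by exists (normc P.[x%:C]), x%:C => //; exists x.
have [C HC] := poly_bounded (poly_Re P) B.
have [D HD] := poly_bounded (poly_Im P) B.
exists (C + D) => _ [_ [y Ay <-] <-]; rewrite horner_ReIm.
by apply: le_trans (normc_le_ReIm _) _; rewrite lerD ?HC ?HD ?A_bnd.
Qed.

Lemma poly_norm_ge (P : {poly R[i]}) x : A x ->
  normc P.[x%:C] <= poly_norm (real_complex R @` A) P.
Proof.
move=> Ax; apply: ub_le_sup; first by have [] := has_sup_norm P.
by exists x%:C => //; exists x.
Qed.

Lemma poly_norm_le (P : {poly R[i]}) M : (forall x, A x -> normc P.[x%:C] <= M) ->
  poly_norm (real_complex R @` A) P <= M.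
Proof.
move=> H; apply: ge_sup; first by have [] := has_sup_norm P.
by move=> _ [_ [y Ay <-] <-]; exact: H.
Qed.

Lemma admissible_ge0 n M : admissible A n M -> 0 <= M.
Proof.
by move=> [q [_ _ H]]; have [x /H] := A0; apply: le_trans.
Qed.

Lemma min_dev_le n M : admissible A n M -> min_dev (real_complex R @` A) n <= M.
Proof.
move=> [q [sq q0 qM]]; apply: le_trans (_ : poly_norm (real_complex R @` A) (toC q) <= M).
  apply: ge_inf; last first.
    exists (toC q) => //; split; first by rewrite size_map_poly.
    by rewrite -[0](rmorph0 (real_complex R)) horner_map /= q0.
  exists 0 => _ [P _ <-]; have [x Ax] := A0.
  exact: le_trans (normc_ge0 _) (poly_norm_ge P Ax).
by apply: poly_norm_le => x Ax; rewrite horner_map normc_real qM.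
Qed.

(** Replacing the coefficients of a complex competitor by their real parts keeps the value 1 at 0
    and does not increase the norm on a real set. *)
Lemma min_dev_adherent n M : min_dev (real_complex R @` A) n < M ->
  exists2 M', M' < M & admissible A n M'.
Proof.
move=> /inf_lt[]; first by exists (poly_norm (real_complex R @` A) 1), 1 => //; split;
  [rewrite size_poly1|rewrite hornerC].
move=> _ [P [sP P0] <-] PM; exists (poly_norm (real_complex R @` A) P) => //.
exists (poly_Re P); split; first exact: leq_trans (size_poly _ _) sP.
  by have := horner_ReIm P 0; rewrite P0 => -[].
move=> x Ax; apply: le_trans (poly_norm_ge P Ax); rewrite horner_ReIm.
exact: (normRe_le_normc (_ +i* _)).
Qed.

End Bounded.

Lemma continuous_sum_fun (T : topologicalType) n (f : 'I_n -> T -> R) :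
  (forall i, continuous (f i)) -> continuous (fun v => \sum_(i < n) f i v).
Proof.
move=> cf; elim: n f cf => [|n IH] f cf v.
  by under eq_fun do rewrite big_ord0; exact: cvg_cst.
under eq_fun do rewrite big_ord_recl.
by apply: (@continuousD _ R) ; [exact: cf|apply: IH].
Qed.

(* Inverting a Vandermonde matrix at [n.+1] points of the segment. *)
Lemma coef_bounded n x y : x < y -> exists C, forall q M,
  (size q <= n.+1)%N -> (forall z, x <= z <= y -> `|q.[z]| <= M) ->
  forall i, `|q`_i| <= C * M.
Proof.
move=> xy; pose a := \row_(i < n.+1) (x + (y - x) * (i%:R / n.+1%:R)) : 'rV[R]_n.+1.
have aE i : a 0 i = x + (y - x) * (i%:R / n.+1%:R) by rewrite mxE.
have a_itv i : x <= a 0 i <= y.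
  have h1 : 0 <= i%:R / n.+1%:R :> R by rewrite divr_ge0.
  have h2 : i%:R / n.+1%:R <= 1 :> R.
    by rewrite ler_pdivrMr // mul1r ler_nat ltnW.
  have d0 : 0 <= y - x by rewrite subr_ge0 ltW.
  by rewrite aE lerDl mulr_ge0 //= -lerBrDl ler_piMr.
pose V := Vandermonde n.+1 a.
have Vu : V \in unitmx.
  rewrite unitmxE det_Vandermonde unitfE; apply/prodf_neq0 => i _; apply/prodf_neq0 => j ij.
  rewrite !aE (_ : _ - _ = (y - x) * ((j%:R - i%:R) / n.+1%:R)); last by ring.
  rewrite mulf_neq0 ?subr_eq0 ?gt_eqF // divr_gt0 // subr_gt0 ltr_nat //.
exists (\sum_(i < n.+1) \sum_(j < n.+1) `|invmx V j i|) => q M sq qM i.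
have M0 : 0 <= M by apply: le_trans (normr_ge0 _) (qM x _); rewrite lexx ltW.
have S0 : 0 <= \sum_(i < n.+1) \sum_(j < n.+1) `|invmx V j i|.
  by apply: sumr_ge0 => k _; apply: sumr_ge0.
have [ni|ni] := leqP n.+1 i.
  by rewrite nth_default ?normr0 ?mulr_ge0 // (leq_trans sq).
pose u := \row_(i < n.+1) q`_i : 'rV[R]_n.+1; pose w := \row_(i < n.+1) q.[a 0 i] : 'rV[R]_n.+1.
have uw : u = w *m invmx V.
  suff -> : w = u *m V by rewrite mulmxK.
  apply/rowP => j; rewrite !mxE (horner_coef_wide _ sq); apply: eq_bigr => k _.
  by rewrite !mxE.
have -> : q`_i = u 0 (Ordinal ni) by rewrite mxE.
rewrite uw mxE (le_trans (ler_norm_sum _ _ _)) //.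
rewrite [in leRHS](bigD1 (Ordinal ni)) //= mulrDl ler_wpDr //.
  by rewrite mulr_ge0 //; apply: sumr_ge0 => k _; apply: sumr_ge0.
rewrite mulr_suml; apply: ler_sum => j _; rewrite normrM mulrC ler_wpM2l //.
by rewrite mxE qM.
Qed.

(** Compactness: bound and coefficients together form a vector in a closed set, bounded by
    [coef_bounded] because [A] contains a segment. The bound is a continuous coordinate, so it
    attains its minimum. *)
Lemma min_dev_attained A (B : R) n : (forall x, A x -> `|x| <= B) ->
  (exists x y, x < y /\ (forall z, x <= z <= y -> A z)) ->
  admissible A n (min_dev (real_complex R @` A) n).
Proof.
move=> A_bnd [x [y [xy xyA]]]; set L := min_dev _ n.
have A0 : A !=set0 by exists x; apply: xyA; rewrite lexx ltW.
(* [v 0 0] is the bound, the other entries of [v] are the coefficients. *)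
pose Q (v : 'rV[R]_n.+2) := \poly_(i < n.+1) v 0 (inord i.+1).
have cQ z : continuous (fun v => (Q v).[z]).
  under eq_fun do rewrite horner_poly.
  apply: continuous_sum_fun => i v.
  exact: (cvgM (@coord_continuous R 1 n.+2 0 (inord i.+1) v) (cvg_cst _)).
have [C HC] := coef_bounded n xy.
pose K := [set v : 'rV[R]_n.+2 | [/\ v 0 ord0 <= L + 1, (Q v).[0] = 1 &
   forall z, A z -> `|(Q v).[z]| <= v 0 ord0]].
have Kv v : K v -> admissible A n (v 0 ord0).
  by move=> [_ h1 h2]; exists (Q v); split => //; exact: size_poly.
have vK M : M <= L + 1 -> admissible A n M -> exists2 v, K v & v 0 ord0 = M.
  move=> ML [q [sq q0 qM]].
  pose v : 'rV[R]_n.+2 := \row_(i < n.+2) if i == 0%N :> nat then M else q`_i.-1.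
  have Qv : Q v = q.
    apply/polyP => i; rewrite coef_poly; case: ltnP => ni.
      by rewrite mxE inordK.
    by rewrite nth_default // (leq_trans sq).
  exists v; last by rewrite mxE.
  by split; rewrite ?Qv // mxE.
have Kcl : closed K.
  pose K1 := [set v : 'rV[R]_n.+2 | v 0 ord0 <= L + 1].
  pose K2 := [set v : 'rV[R]_n.+2 | (Q v).[0] = 1].
  pose K3 z := [set v : 'rV[R]_n.+2 | `|(Q v).[z]| - v 0 ord0 <= 0].
  have -> : K = K1 `&` (K2 `&` \bigcap_(z in A) K3 z).
    apply/seteqP; split => v /=.
      by move=> [h1 h2 h3]; split => //; split => // z Az; rewrite /K3 /= subr_le0 h3.
    by move=> [h1 [h2 h3]]; split => // z Az; rewrite -subr_le0; exact: h3.
  apply: closedI; last apply: closedI.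
  - apply: (@preimage_closed _ _ (fun v : 'rV[R]_n.+2 => v 0 ord0) [set t | t <= L + 1]).
      by move=> v _; exact: coord_continuous.
    exact: closed_le.
  - apply: (@preimage_closed _ _ (fun v : 'rV[R]_n.+2 => (Q v).[0]) [set 1]).
      by move=> v _; exact: cQ.
    exact: closed_eq.
  - apply: closed_bigI => z _.
    apply: (@preimage_closed _ _ (fun v : 'rV[R]_n.+2 => `|(Q v).[z]| - v 0 ord0) [set t | t <= 0]).
      move=> v _.
      exact: (cvgB (cvg_norm (cQ z v)) (@coord_continuous R 1 n.+2 0 ord0 v)).
    exact: closed_le.
have Kcp : compact K.
  (* The factor 1 serves the entry that holds the bound, the factor [C] the coefficients. *)
  pose b : R := Num.max 1 C * (`|L| + 1).
  have h : compact [set v : 'rV[R]_n.+2 | forall i, v 0 i \in `[- b, b]].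
    apply: (@rV_compact _ _ (fun=> `[- b, b]%classic)) => i.
    exact: segment_compact.
  apply: subclosed_compact Kcl h _ => v vk i.
  have [h1 h2 h3] := vk; have v0 := admissible_ge0 A0 (Kv v vk).
  have vL : v 0 ord0 <= `|L| + 1 by apply: le_trans h1 _; rewrite lerD2r ler_norm.
  rewrite in_itv /= -ler_norml /b.
  have [i0|i0] := posnP i.
    have -> : i = ord0 by apply: val_inj.
    rewrite ger0_norm // (le_trans vL) // ler_peMl ?(le_trans v0) //.
    by rewrite le_max lexx.
  have -> : v 0 i = (Q v)`_i.-1.
    by rewrite coef_poly prednK // -ltnS ltn_ord inord_val.
  apply: (@le_trans _ _ (C * v 0 ord0)).
    by apply: HC => [|z /xyA]; [exact: size_poly|exact: h3].
  apply: (@le_trans _ _ (Num.max 1 C * v 0 ord0)).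
    by rewrite ler_wpM2r // le_max lexx orbT.
  by rewrite ler_wpM2l // le_max ler01.
have K0 : K !=set0.
  have [|M ML adM] := @min_dev_adherent A B A0 A_bnd n (L + 1); first by rewrite ltrDl.
  by have [v vk _] := vK M (ltW ML) adM; exists v.
have [|v] := EVT_min_rV (f := fun v => v 0 ord0) K0 Kcp.
  by apply: continuous_subspaceT => v; exact: coord_continuous.
rewrite inE => vk vmin.
suff -> : L = v 0 ord0 by exact: Kv.
apply/eqP; rewrite eq_le (min_dev_le A0 A_bnd (Kv v vk)) /= leNgt; apply/negP => Lv.
have [M Mv adM] := min_dev_adherent A0 A_bnd Lv.
have [|w wk wM] := vK M _ adM; first by have [h _ _] := vk; apply: le_trans (ltW Mv) h.
by have := vmin w; rewrite inE wM leNgt Mv => /(_ wk).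
Qed.

End MinDev.

(** * Iterates of the second Chebyshev polynomial *)

Definition cheb2 (T : pzRingType) (x : T) : T := x ^+ 2 *+ 2 - 1.

Section Cheb2.
Variable R : realType.
Implicit Types (p q : {poly R}) (x y u v w : R).

Local Notation toC p := (map_poly (real_complex R) p).

Lemma horner_iter_cheb2 (T : comNzRingType) j (p : {poly T}) (x : T) :
  (iter j (@cheb2 _) p).[x] = iter j (@cheb2 _) p.[x].
Proof.
elim: j => //= j <-; rewrite {1}/cheb2 hornerD hornerMn hornerN hornerC.
by rewrite horner_exp.
Qed.

Lemma map_iter_cheb2 j p : toC (iter j (@cheb2 _) p) = iter j (@cheb2 _) (toC p).
Proof.
by elim: j => //= j <-; rewrite /cheb2 rmorphB rmorphMn rmorphXn rmorph1.
Qed.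

Lemma size_iter_cheb2_le j n p : (size p <= n.+1)%N ->
  (size (iter j (@cheb2 _) p) <= (n * 2 ^ j).+1)%N.
Proof.
move=> sp; elim: j => [|j IH]; first by rewrite expn0 muln1.
rewrite iterS /cheb2; apply: leq_trans (size_polyD _ _) _.
rewrite size_polyN size_poly1 geq_max /= andbT.
rewrite -scaler_nat; apply: leq_trans (size_scale_leq _ _) _.
apply: leq_trans (size_poly_exp_leq _ _) _.
rewrite expnSr mulnA ltnS leq_mul2r /=; move: IH; case: size => //.
Qed.

Lemma size_iter_cheb2 j n p : (0 < n)%N -> size p = n.+1 ->
  size (iter j (@cheb2 _) p) = (n * 2 ^ j).+1.
Proof.
move=> n0 sp; elim: j => [|j IH]; first by rewrite expn0 muln1.
rewrite iterS; set q := iter j _ p in IH *.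
have sq : size (q ^+ 2 *+ 2) = (n * 2 ^ j.+1).+1.
  rewrite -scaler_nat size_scale ?pnatr_eq0 // -[LHS]prednK.
    by rewrite size_exp IH /= expnSr mulnA.
  by rewrite size_poly_gt0 expf_neq0 // -size_poly_gt0 IH.
by rewrite /cheb2 size_polyDl // size_polyN size_poly1 sq ltnS muln_gt0 n0 expn_gt0.
Qed.

(** 2 x^2 - 1 is never below -1, and is at most 1 iff x^2 <= 1. Hence all iterates on [p] share the
    set where [|p| <= 1]. *)
Lemma norm_cheb2_le1 x : (`|cheb2 x| <= 1) = (`|x| <= 1).
Proof.
rewrite -[in RHS](ler_pXn2r (ltn0Sn 1)) ?nnegrE // expr1n real_normK ?num_real //.
rewrite /cheb2 ler_norml; have x2 := sqr_ge0 x.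
by apply/idP/idP; lra.
Qed.

Lemma norm_iter_cheb2_le1 j x : (`|iter j (@cheb2 _) x| <= 1) = (`|x| <= 1).
Proof. by elim: j => //= j <-; rewrite norm_cheb2_le1. Qed.

(** If 2 w^2 - 1 = c lies in [-1,1], the complex number [w] must be plus or minus the square root of
    (c + 1) / 2, again in [-1,1]. *)
Lemma cheb2_real_preimage p : real_preimage p -> real_preimage (cheb2 p).
Proof.
move=> Hp z [c /= ]; rewrite in_itv /= => /andP[c1 c2].
rewrite -[cheb2 p]/(iter 1 (@cheb2 _) p) map_iter_cheb2 horner_iter_cheb2 /=.
set w := (_).[z] => cw; pose s := Num.sqrt ((c + 1) / 2).
have s2 : s ^+ 2 = (c + 1) / 2 by rewrite sqr_sqrtr //; lra.
have s1 : s <= 1.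
  by rewrite -(expr_le1 (ltn0Sn 1)) ?sqrtr_ge0 // s2; lra.
have s0 : 0 <= s := sqrtr_ge0 _.
have /eqP : w ^+ 2 = s%:C ^+ 2.
  rewrite -rmorphXn s2; apply: (@mulIf _ 2); first by rewrite pnatr_eq0.
  rewrite mulr_natr -[LHS](subrK 1) -[_ - 1]/(cheb2 w) -cw.
  rewrite -(rmorph1 (real_complex R)) -rmorphD -(rmorph_nat (real_complex R)) -rmorphM.
  by congr (_%:C); lra.
rewrite eqf_sqr => /orP[]/eqP wE; apply: Hp.
  by exists s => //=; rewrite in_itv /=; lra.
by exists (- s); rewrite /= ?rmorphN // in_itv /=; lra.
Qed.

Lemma iter_cheb2_real_preimage j p :
  real_preimage p -> real_preimage (iter j (@cheb2 _) p).
Proof. by move=> Hp; elim: j => //= j; exact: cheb2_real_preimage. Qed.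

(* [(joukowski u)^-1 = (u + u^-1) / 2], on which [cheb2] acts as squaring of [u]. *)
Definition joukowski u := 2 * u / (1 + u ^+ 2).

Lemma joukowski_den u : 0 < 1 + u ^+ 2.
Proof. by have := sqr_ge0 u; lra. Qed.

Lemma iter_cheb2_joukowski j u : 0 < u ->
  iter j (@cheb2 _) (joukowski u)^-1 = (joukowski (u ^+ (2 ^ j)))^-1.
Proof.
move=> u0; elim: j => [|j IH]; first by rewrite expn0 expr1.
rewrite iterS IH expnSr exprM; set v := u ^+ _.
have v0 : 0 < v by rewrite exprn_gt0.
have d1 := joukowski_den v; have d2 := joukowski_den (v ^+ 2).
rewrite /cheb2 /joukowski; field.
by rewrite !gt_eqF.
Qed.

(** After clearing denominators the difference is 2 (v - u) (1 - u v). *)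
Lemma joukowski_lt u v : 0 <= u -> u < v -> v <= 1 -> joukowski u < joukowski v.
Proof.
move=> u0 uv v1; rewrite /joukowski ltr_pdivrMr ?joukowski_den // mulrAC.
rewrite ltr_pdivlMr ?joukowski_den //.
have : 0 < (v - u) * (1 - u * v).
  rewrite mulr_gt0 ?subr_gt0 //; nra.
nra.
Qed.

(** With [joukowski_ge], this makes [joukowski] comparable to the identity on [0,1]; the factor 2
    disappears on taking high roots. *)
Lemma joukowski_le2 u : 0 <= u -> joukowski u <= 2 * u.
Proof.
move=> u0; rewrite /joukowski ler_pdivrMr ?joukowski_den // ler_peMr ?mulr_ge0 //.
by have := sqr_ge0 u; lra.
Qed.

Lemma joukowski_ge u : 0 <= u -> u <= 1 -> u <= joukowski u.
Proof.
move=> u0 u1; rewrite /joukowski ler_pdivlMr ?joukowski_den // mulrC ler_wpM2r //.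
by have : u ^+ 2 <= 1 by [rewrite expr_le1]; lra.
Qed.

Lemma joukowski_surj M : 0 < M < 1 -> exists u, [/\ 0 < u, u < 1 & joukowski u = M].
Proof.
move=> /andP[M0 M1]; pose s := Num.sqrt (1 - M ^+ 2).
have s2 : s ^+ 2 = 1 - M ^+ 2 by rewrite sqr_sqrtr //; nra.
have s0 : 0 <= s := sqrtr_ge0 _.
have s1 : s < 1 by rewrite -(@expr_lt1 _ 2) // s2; nra.
(* The smaller root of M u^2 - 2 u + M = 0; the other one is its inverse. *)
exists ((1 - s) / M); split.
- by rewrite divr_gt0 // subr_gt0.
- rewrite ltr_pdivrMr // mul1r; nra.
- have M2 : M ^+ 2 = 1 - s ^+ 2 by lra.
  rewrite /joukowski expr_div_n; apply/eqP.
  have d : M ^+ 2 + (1 - s) ^+ 2 != 0.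
    by rewrite gt_eqF // ltr_pwDl ?sqr_ge0 // exprn_gt0.
  have -> : 1 + (1 - s) ^+ 2 / M ^+ 2 = (M ^+ 2 + (1 - s) ^+ 2) / M ^+ 2.
    by field; rewrite gt_eqF.
  have -> : 2 * ((1 - s) / M) / ((M ^+ 2 + (1 - s) ^+ 2) / M ^+ 2) =
     2 * (1 - s) * M / (M ^+ 2 + (1 - s) ^+ 2).
    by field; rewrite d gt_eqF.
  by apply/eqP/(canLR (mulfK d)); rewrite M2; ring.
Qed.

Lemma iter_cheb2_cos j x : iter j (@cheb2 _) (cos x) = cos (2 ^+ j * x).
Proof.
elim: j => [|j IH]; first by rewrite expr0 mul1r.
rewrite iterS IH exprS -mulrA; set y := _ * x.
by rewrite /cheb2 mulr_natl mulr2n cosD -!expr2 sin2cos2; ring.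
Qed.

Lemma cos_half_odd_pi k : cos ((k%:R + 2^-1) * pi) = 0 :> R.
Proof.
elim: k => [|k IH]; first by rewrite add0r mulrC cos_pihalf.
by rewrite -natr1 addrAC mulrDl mul1r cosDpi IH oppr0.
Qed.

(** The numbers cos ((k + 1/2) pi / 2^j) are zeros of the [j]-th iterate, and their angles become
    dense. Two distinct zeros are produced because a gap may still contain one. *)
Lemma cheb2_zeros_dense w e : -1 <= w <= 1 -> 0 < e -> exists j x y,
  [/\ -1 <= x <= 1, -1 <= y <= 1, x != y, `|x - w| < e /\ `|y - w| < e &
   iter j (@cheb2 _) x = 0 /\ iter j (@cheb2 _) y = 0].
Proof.
move=> w1 e0; have [/andP[t0 tpi] tw] := acos_def w1; set t := acos w in t0 tpi tw.
have [d d0 Hd] : exists2 d, 0 < d & forall s, `|s - t| < d -> `|cos s - w| < e.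
  have /cvgrPdist_lt/(_ _ e0) := @continuous_cos R t.
  move=> /nbhs_ballP[d d0 H]; exists d => // s st.
  by rewrite -tw distrC; apply: H; rewrite /ball /= distrC.
have pi0 := pi_gt0 R.
(* The interval of angles lies on one side of [t] to stay within [0, pi], where the cosine is
   injective. *)
have [a [b [a0 ab bpi Hab]]] : exists a b, [/\ 0 <= a, a < b, b <= pi &
    forall s, a <= s <= b -> `|s - t| < d].
  have [tp|tp] := ltP t pi.
    exists t, (Num.min pi (t + d / 2)); split => //.
    - by rewrite lt_min tp ltrDl divr_gt0.
    - by rewrite ge_min lexx.
    - move=> s /andP[ts]; rewrite le_min => /andP[_ st].
      by rewrite ger0_norm; lra.
  exists (Num.max 0 (pi - d / 2)), pi; split => //.
  - by rewrite le_max lexx.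
  - by rewrite gt_max pi0 /=; lra.
  - move=> s /andP[]; rewrite ge_max => /andP[_ st] sp.
    by rewrite ler0_norm; lra.
(* Rounding up to [k] costs at most pi, and the second angle another 3 pi / 2; a scaled length above
   3 pi leaves room for both. *)
pose N := Num.truncn (3 * pi / (b - a)).
have Nj : 3 * pi < 2 ^+ N.+1 * (b - a).
  rewrite -ltr_pdivrMr ?subr_gt0 //; apply: lt_trans (truncnS_gt _) _.
  by rewrite -natrX ltr_nat ltn_expl.
set c := 2 ^+ N.+1 in Nj; have c0 : 0 < c by rewrite exprn_gt0.
pose k := (Num.truncn (c * a / pi)).+1.
have k1 : c * a < k%:R * pi by rewrite -ltr_pdivrMr // truncnS_gt.
have k2 : k%:R * pi <= c * a + pi.
  rewrite /k -natr1 mulrDl mul1r lerD2r -ler_pdivlMr // truncn_le //.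
  by rewrite divr_ge0 ?mulr_ge0 // ltW.
pose f i := ((k + i)%:R + 2^-1) * pi / c.
have fab i : (i <= 1)%N -> a <= f i <= b.
  move=> i1; have i2 : (i%:R <= 1 :> R) by rewrite lern1.
  have i3 : 0 <= i%:R :> R by [].
  rewrite /f natrD ler_pdivlMr // ler_pdivrMr //; nra.
have fpi i : (i <= 1)%N -> f i \in `[0, pi].
  by move=> /fab /andP[fa fb]; rewrite in_itv /= (le_trans a0) // (le_trans fb).
have f0 i : iter N.+1 (@cheb2 _) (cos (f i)) = 0.
  by rewrite iter_cheb2_cos -/c /f mulrCA divff ?gt_eqF // mulr1 cos_half_odd_pi.
exists N.+1, (cos (f 0%N)), (cos (f 1%N)); split; last by split.
- by rewrite cos_geN1 cos_le1.
- by rewrite cos_geN1 cos_le1.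
- apply/negP => /eqP /(can_in_inj (@cosK R)).
  have c' : c^-1 != 0 by rewrite invr_eq0 gt_eqF.
  have pi' : pi != 0 :> R by rewrite gt_eqF.
  move=> /(_ (fpi 0%N isT) (fpi 1%N isT)) /(mulIf c') /(mulIf pi') /addIr /eqP.
  by rewrite eqr_nat addn0 addn1 ltn_eqF.
- by split; apply/Hd/Hab/fab.
Qed.

(* [F - k G X^2] is [F (1 - k x^2 / d)]. *)
Lemma smaller_norm_of_factor (A : set R) (B c e : R) N F G (d : {poly R}) :
  A !=set0 -> (forall x, A x -> `|x| <= B) ->
  0 < c -> (forall x, A x -> c <= x ^+ 2) ->
  0 < e -> (forall x, A x -> e <= d.[x]) ->
  F = G * d -> (size F <= N.+1)%N -> (size G + 2 <= N.+1)%N -> F.[0] != 0 ->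
  (forall x, A x -> `|F.[x]| <= 1) ->
  exists2 M, M < `|F.[0]|^-1 & admissible A N M.
Proof.
move=> [x0 Ax0] A_bnd c0 Ac e0 Ae FE sF sG F0 F1.
have [D HD] := poly_bounded d B.
have D0 : 0 < D.
  apply: lt_le_trans e0 (le_trans (Ae _ Ax0) (le_trans (ler_norm _) (HD _ (A_bnd _ Ax0)))).
have B1 : 0 < B ^+ 2 + 1 by have := sqr_ge0 B; lra.
(* This [k] gives k x^2 <= e <= d on [A], so the factor 1 - k x^2 / d stays nonnegative. *)
pose k := e / (B ^+ 2 + 1); have k0 : 0 < k by rewrite divr_gt0.
(* From x^2 >= c and d <= D, the factor 1 - k x^2 / d is at most [r]. *)
pose r := 1 - k * c / D.
have r1 : r < 1 by rewrite /r ltrBlDr ltrDl divr_gt0 // mulr_gt0.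
have step x : A x -> 0 <= d.[x] - k * x ^+ 2 <= r * d.[x].
  move=> Ax; have dx : e <= d.[x] := Ae x Ax; have xc := Ac x Ax.
  have dD : d.[x] <= D := le_trans (ler_norm _) (HD _ (A_bnd _ Ax)).
  have xB : x ^+ 2 <= B ^+ 2.
    by rewrite -real_normK ?num_real // lerXn2r ?nnegrE ?A_bnd // (le_trans _ (A_bnd _ Ax)).
  have h1 : k * x ^+ 2 <= e.
    rewrite /k mulrAC ler_pdivrMr // ler_pM2l //; lra.
  have h2 : k * c / D * d.[x] <= k * x ^+ 2.
    rewrite mulrAC ler_pdivrMr //.
    apply: ler_pM => //; first by rewrite mulr_ge0 // ltW.
      exact: le_trans (ltW e0) dx.
    by rewrite ler_wpM2l // ltW.
  by rewrite /r mulrBl mul1r; lra.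
have r0 : 0 <= r.
  have /andP[h1 h2] := step _ Ax0.
  by rewrite -(pmulr_lge0 _ (lt_le_trans e0 (Ae _ Ax0))) (le_trans h1).
exists (r * `|F.[0]|^-1); first by rewrite gtr_pMl // invr_gt0 normr_gt0.
exists (F.[0]^-1 *: (G * (d - k *: 'X^2))); split.
- rewrite mulrBr -FE; apply: leq_trans (size_scale_leq _ _) _.
  apply: leq_trans (size_polyD _ _) _; rewrite geq_max sF size_polyN -scalerAr.
  apply: leq_trans (size_scale_leq _ _) _; apply: leq_trans (size_polyMleq _ _) _.
  by rewrite size_polyXn addnS /=.
- by rewrite hornerZ hornerM hornerD hornerN hornerZ hornerXn expr0n mulr0 subr0 -hornerM -FE mulVf.
- move=> x Ax; have /andP[h1 h2] := step _ Ax.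
  rewrite hornerZ hornerM hornerD hornerN hornerZ hornerXn.
  rewrite normrM normfV mulrC ler_wpM2r ?invr_ge0 // normrM.
  rewrite (ger0_norm h1); apply: le_trans (_ : `|G.[x]| * (r * d.[x]) <= _).
    by rewrite ler_wpM2l.
  have := F1 x Ax; rewrite FE hornerM normrM (ger0_norm (le_trans (ltW e0) (Ae _ Ax))).
  by move=> h; rewrite mulrCA ler_piMr.
Qed.

End Cheb2.

(** * The lower bound and inverse images *)

Section RootsNear.
Variable R : realType.
Implicit Types (p : {poly R}) (w : R).

Local Notation toC p := (map_poly (real_complex R) p).
Local Notation normc := ComplexField.Normc.normc.

Lemma normc_distC (z z' : R[i]) : normc (z - z') = normc (z' - z).
Proof. by rewrite -opprB; case: (z' - z) => a b /=; rewrite !sqrrN. Qed.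

Lemma normc_prod (I : Type) (s : seq I) (f : I -> R[i]) :
  normc (\prod_(i <- s) f i) = \prod_(i <- s) normc (f i).
Proof.
elim: s => [|i s IH]; first by rewrite !big_nil ComplexField.Normc.normc1.
by rewrite !big_cons ComplexField.Normc.normcM IH.
Qed.

(** The distances from [z0] to the roots of [p - w] multiply to |w - w0| / |lead_coef p|, so they
    cannot all be at least [d] when [w] is close to [w0]. *)
Lemma root_near p z0 w0 (d : R) : (1 < size p)%N -> (toC p).[z0] = w0%:C -> 0 < d ->
  exists2 e, 0 < e & forall w, `|w - w0| < e ->
    exists2 z, (toC p).[z] = w%:C & normc (z - z0) < d.
Proof.
move=> sp pz0 d0; have lc0 : lead_coef p != 0.
  by rewrite lead_coef_eq0 -size_poly_eq0; case: size sp.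
exists (`|lead_coef p| * d ^+ (size p).-1).
  by rewrite mulr_gt0 ?normr_gt0 ?exprn_gt0.
move=> w; apply: contraPP => H.
pose q := toC p - (w%:C)%:P.
have sq : size q = size p.
  rewrite size_polyDl size_map_poly // size_polyN.
  exact: leq_ltn_trans (size_polyC_leq1 _) sp.
have lq : lead_coef q = (lead_coef p)%:C.
  rewrite lead_coefDl ?lead_coef_map // size_map_poly size_polyN.
  exact: leq_ltn_trans (size_polyC_leq1 _) sp.
have [rs Dq] := closed_field_poly_normal q.
have srs : size rs = (size p).-1.
  rewrite -sq Dq size_scale ?size_prod_XsubC //.
  by rewrite lq -(rmorph0 (real_complex R)) (inj_eq (@complexI R)).
have qz0 : `|w - w0| = normc q.[z0].
  by rewrite !hornerE pz0 -rmorphB normc_real distrC.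
apply/negP; rewrite -leNgt qz0 Dq lq hornerZ ComplexField.Normc.normcM normc_real.
rewrite ler_wpM2l // horner_prod normc_prod -srs.
have : forall r, r \in rs -> d <= normc (z0 - r).
  move=> r rrs; rewrite leNgt; apply/negP => rd; apply: H; exists r.
    apply/eqP; rewrite -subr_eq0; have : root q r.
      rewrite Dq rootZ ?root_prod_XsubC // lq -(rmorph0 (real_complex R)).
      by rewrite (inj_eq (@complexI R)).
    by rewrite rootE !hornerE.
  by rewrite normc_distC.
elim: rs {Dq srs} => [|r rs IH] Hr; first by rewrite big_nil expr0.
rewrite big_cons exprS hornerXsubC ler_pM ?exprn_ge0 ?(ltW d0) //.
  by rewrite Hr ?mem_head.
by apply: IH => s srs; rewrite Hr // inE srs orbT.
Qed.

End RootsNear.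

(** * Minimum deviation and convergence factor of a compact real set avoiding 0 *)

Section RealSet.
Variables (R : realType) (A : set R) (B : R).
Hypothesis A_bnd : forall x, A x -> `|x| <= B.
Hypothesis Aseg : exists x y, x < y /\ (forall z, x <= z <= y -> A z).
Hypothesis Acl : closed A.
Hypothesis A00 : ~ A 0.
Implicit Types (p q : {poly R}) (x y u M : R) (n j : nat).

Local Notation toC p := (map_poly (real_complex R) p).
Local Notation normc := ComplexField.Normc.normc.
Let S := real_complex R @` A.
Let L n := min_dev S n.
Let kappa := conv_factor S.

Lemma segment_nonempty : A !=set0.
Proof. by have [x [y [xy H]]] := Aseg; exists x; apply: H; rewrite lexx ltW. Qed.

Lemma min_dev_le_of_admissible n M : admissible A n M -> L n <= M.
Proof. move=> H; exact: (min_dev_le segment_nonempty A_bnd H). Qed.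

Lemma min_dev_admissible n : admissible A n (L n).
Proof. exact: (min_dev_attained n A_bnd Aseg). Qed.

Lemma poly_eq0_on_set p : (forall x, A x -> p.[x] = 0) -> p = 0.
Proof.
move=> H; have [x [y [xy xyA]]] := Aseg.
have [C HC] := coef_bounded (size p) xy.
apply/polyP => i; rewrite coef0; apply/eqP; rewrite -normr_le0.
apply: le_trans (HC p 0 (leqnSn _) _ i) _; last by rewrite mulr0.
by move=> z /xyA/H ->; rewrite normr0.
Qed.

Lemma min_dev_ge0 n : 0 <= L n.
Proof. exact: (admissible_ge0 segment_nonempty (min_dev_admissible n)). Qed.

Lemma min_dev_gt0 n : 0 < L n.
Proof.
rewrite lt_neqAle min_dev_ge0 andbT eq_sym; apply/eqP => L0.
have [q [_ q0 qL]] := min_dev_admissible n.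
have /eqP := q0; rewrite (@poly_eq0_on_set q) ?hornerC 1?eq_sym ?oner_eq0 // => x /qL.
by rewrite L0 normr_le0 => /eqP.
Qed.

Lemma min_dev_le1 n : L n <= 1.
Proof.
apply: min_dev_le_of_admissible; exists 1; split; rewrite ?size_poly1 ?hornerC //.
by move=> x _; rewrite hornerC normr1.
Qed.

Lemma min_dev_submul m k : L (m + k) <= L m * L k.
Proof.
apply: min_dev_le_of_admissible; have [p [sp p0 pL]] := min_dev_admissible m.
have [q [sq q0 qL]] := min_dev_admissible k.
exists (p * q); split; last 2 first.
- by rewrite hornerM p0 q0 mulr1.
- by move=> x Ax; rewrite hornerM normrM ler_pM ?pL ?qL.
apply: leq_trans (size_polyMleq _ _) _.
by rewrite -subn1 leq_subLR add1n (leq_trans (leq_add sp sq)) // addSn addnS.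
Qed.

Lemma min_dev_decr n : L n.+1 <= L n.
Proof.
have [p [sp p0 pL]] := min_dev_admissible n.
by apply: min_dev_le_of_admissible; exists p; split => //; exact: leqW.
Qed.

Lemma sqr_away : exists2 c, 0 < c & forall x, A x -> c <= x ^+ 2.
Proof.
have : nbhs (0 : R) (~` A) by apply: open_nbhs_nbhs; split => //; exact: closed_openC.
move=> /nbhs_ballP[e /= e0 He]; exists (e ^+ 2); first by rewrite exprn_gt0.
move=> x Ax; rewrite -[leRHS]real_normK ?num_real // lerXn2r ?nnegrE ?(ltW e0) //.
by rewrite leNgt; apply/negP => xe; apply: (He x) => //; rewrite /ball /= sub0r normrN.
Qed.

Lemma conv_factor_ge0 : 0 <= kappa.
Proof. exact: lim_root_ge0 min_dev_ge0 min_dev_le1 min_dev_submul. Qed.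

Lemma conv_factor_exp_le k : (0 < k)%N -> kappa ^+ k <= L k.
Proof. exact: lim_root_exp_le min_dev_ge0 min_dev_le1 min_dev_submul k. Qed.

(** It is enough that [L 2 < 1]: the competitor 1 - X^2 / (B^2 + 1) lies between 0 and a constant
    below 1 on [A], which is bounded and stays away from 0. *)
Lemma conv_factor_lt1 : kappa < 1.
Proof.
have [c c0 Ac] := sqr_away; have B1 : 0 < B ^+ 2 + 1 by have := sqr_ge0 B; lra.
have : L 2 <= 1 - c / (B ^+ 2 + 1).
  apply: min_dev_le_of_admissible; exists (1 - (B ^+ 2 + 1)^-1 *: 'X^2); split.
  - apply: leq_trans (size_polyD _ _) _; rewrite size_poly1 size_polyN geq_max /=.
    by apply: leq_trans (size_scale_leq _ _) _; rewrite size_polyXn.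
  - by rewrite hornerD hornerN hornerZ hornerXn hornerC expr0n mulr0 subr0.
  - move=> x Ax; rewrite hornerD hornerN hornerZ hornerXn hornerC mulrC.
    have xB : x ^+ 2 <= B ^+ 2.
      by rewrite -real_normK ?num_real // lerXn2r ?nnegrE ?A_bnd // (le_trans _ (A_bnd Ax)).
    have h : x ^+ 2 / (B ^+ 2 + 1) <= 1 by rewrite ler_pdivrMr // mul1r; lra.
    by rewrite ger0_norm ?subr_ge0 // lerB // ler_wpM2r ?invr_ge0 ?Ac // ltW.
have := @conv_factor_exp_le 2 isT => h1 h2.
rewrite -(@expr_lt1 _ 2) ?conv_factor_ge0 //; apply: le_lt_trans h1 _; apply: le_lt_trans h2 _.
by rewrite ltrBlDr ltrDl divr_gt0.
Qed.

Lemma joukowski_mono u v : 0 <= u -> u <= v -> v <= 1 -> joukowski u <= joukowski v.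
Proof.
move=> u0; rewrite le_eqVlt => /orP[/eqP -> //|uv] v1.
by rewrite ltW // joukowski_lt.
Qed.

Lemma joukowski_lt1 u : 0 <= u < 1 -> joukowski u < 1.
Proof.
move=> /andP[u0 u1]; have := joukowski_lt u0 u1 (lexx 1).
by rewrite /joukowski expr1n mulr1 -[1 + 1]/2%:R divff // pnatr_eq0.
Qed.

Lemma joukowski_gt0 u : 0 < u -> 0 < joukowski u.
Proof. by move=> u0; rewrite divr_gt0 ?joukowski_den // mulr_gt0. Qed.

Lemma conv_factor_exp_itv n : (0 < n)%N -> 0 <= kappa ^+ n < 1.
Proof.
move=> n0; rewrite exprn_ge0 ?conv_factor_ge0 //=.
by rewrite exprn_ilt1 ?conv_factor_ge0 ?conv_factor_lt1 // -lt0n.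
Qed.

(** The [j]-th iterate on [q / L n] is bounded by 1 on [A]; dividing it by its value at 0 gives the
    competitor. *)
Lemma min_dev_iter_le n j u : 0 < u -> L n = joukowski u ->
  L (n * 2 ^ j) <= joukowski (u ^+ (2 ^ j)).
Proof.
move=> u0 Lu; have [q [sq q0 qL]] := min_dev_admissible n.
pose P := (L n)^-1 *: q; have LP := min_dev_gt0 n.
have P0 : (iter j (@cheb2 _) P).[0] = (joukowski (u ^+ (2 ^ j)))^-1.
  by rewrite horner_iter_cheb2 hornerZ q0 mulr1 Lu iter_cheb2_joukowski.
have hpos : 0 < joukowski (u ^+ (2 ^ j)) by rewrite joukowski_gt0 ?exprn_gt0.
apply: min_dev_le_of_admissible; exists (joukowski (u ^+ (2 ^ j)) *: iter j (@cheb2 _) P); split.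
- apply: leq_trans (size_scale_leq _ _) _; apply: size_iter_cheb2_le.
  exact: leq_trans (size_scale_leq _ _) _.
- by rewrite hornerZ P0 divff ?gt_eqF.
- move=> x Ax; rewrite hornerZ normrM (gtr0_norm hpos) ler_piMr ?(ltW hpos) //.
  rewrite horner_iter_cheb2 norm_iter_cheb2_le1 hornerZ normrM normfV (gtr0_norm LP).
  by rewrite ler_pdivrMl // mulr1 qL.
Qed.

(** With [L n = joukowski u], kappa^(n 2^m) <= L (n 2^m) <= 2 u^(2^m) for all [m]. This gives
    kappa^n <= u, and [joukowski] is increasing on [0,1]. *)
Lemma min_dev_ge_joukowski n : (0 < n)%N -> joukowski (kappa ^+ n) <= L n.
Proof.
move=> n0; have /andP[k0 k1] := conv_factor_exp_itv n0.
have [L1|L1] := leP 1 (L n).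
  by apply: le_trans L1; rewrite ltW // joukowski_lt1 // k0.
have [|u [u0 u1 uL]] := @joukowski_surj _ (L n); first by rewrite min_dev_gt0.
rewrite -uL joukowski_mono // ?(ltW u1) //.
apply: (@le_of_exp_bound _ _ _ 2) => // m.
exists (2 ^ m)%N; first exact/ltnW/ltn_expl.
rewrite -exprM; apply: le_trans (joukowski_le2 _); last by rewrite exprn_ge0 // ltW.
apply: le_trans (min_dev_iter_le _ u0 (esym uL)); apply: conv_factor_exp_le.
by rewrite muln_gt0 n0 expn_gt0.
Qed.

Section Preimage.
Variables (n : nat) (p : {poly R}).
Hypotheses (n0 : (0 < n)%N) (sp : size p = n.+1) (Hp : real_preimage p).
Hypothesis pA : forall x, `|p.[x]| <= 1 <-> A x.

Lemma preimage_norm_gt1 : 1 < `|p.[0]|.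
Proof. by rewrite ltNge; apply/negP => /pA. Qed.

(** The multiple [p.[0] *: q] agrees with [p] at 0 and is below 1 on [A], so the counting of zeros
    applies. Leaving [m] free serves both [n] and [n.+1]. *)
Lemma preimage_below m q : q.[0] = 1 -> (forall x, A x -> `|q.[x]| <= L m) ->
  L m < `|p.[0]|^-1 -> (size p < size q)%N /\
  ((exists s t, [/\ s < 0 < t, A s & A t]) -> ((size p).+1 < size q)%N).
Proof.
move=> q0 qL Lp; have p0 := preimage_norm_gt1.
have p0' : p.[0] != 0 by rewrite -normr_eq0 gt_eqF // (lt_trans _ p0).
pose q' := p.[0] *: q; have sq : size q' = size q by rewrite size_scale.
have q'0 : q'.[0] = p.[0] by rewrite hornerZ q0 mulr1.
have q'1 x : `|p.[x]| <= 1 -> `|q'.[x]| < 1.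
  move=> /pA/qL h; rewrite hornerZ normrM mulrC -ltr_pdivlMr ?normr_gt0 // mul1r.
  exact: le_lt_trans Lp.
have sp1 : (1 < size p)%N by rewrite sp ltnS.
have pB x : `|p.[x]| <= 1 -> `|x| <= B by move=> /pA/A_bnd.
rewrite -sq; split; first exact: extremal_degree Hp sp1 pB p0 q'0 q'1.
move=> [s [t [st /pA ps /pA pt]]].
exact: extremal_degree_hull Hp sp1 pB p0 q'0 q'1 _ _ st ps pt.
Qed.

Lemma preimage_min_dev : L n = `|p.[0]|^-1.
Proof.
have p0 := preimage_norm_gt1.
have p0' : p.[0] != 0 by rewrite -normr_eq0 gt_eqF // (lt_trans _ p0).
apply/eqP; rewrite eq_le; apply/andP; split.
  apply: min_dev_le_of_admissible; exists (p.[0]^-1 *: p); split.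
    by rewrite size_scale ?sp ?invr_eq0.
    by rewrite hornerZ mulVf.
  by move=> x /pA px; rewrite hornerZ normrM normfV ler_piMr // invr_ge0.
rewrite leNgt; apply/negP => Lp; have [q [sq q0 qL]] := min_dev_admissible n.
by have [] := preimage_below q0 qL Lp; rewrite sp ltnNge sq.
Qed.

Lemma preimage_min_dev_succ : (exists s t, [/\ s < 0 < t, A s & A t]) -> L n = L n.+1.
Proof.
move=> st; apply/eqP; rewrite eq_le min_dev_decr andbT leNgt preimage_min_dev; apply/negP => Lp.
have [q [sq q0 qL]] := min_dev_admissible n.+1.
by have [_ /(_ st)] := preimage_below q0 qL Lp; rewrite sp ltnNge sq.
Qed.

End Preimage.

Lemma norm_iter_cheb2_joukowski j x u : 0 < u -> `|x|^-1 = joukowski u ->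
  `|iter j (@cheb2 _) x|^-1 = joukowski (u ^+ (2 ^ j)).
Proof.
move=> u0 xu; case: j => [|j]; first by rewrite expn0 expr1.
(* T_2 is even, so the sign of [x] disappears after one iteration. *)
have -> : iter j.+1 (@cheb2 _) x = iter j.+1 (@cheb2 _) `|x|.
  by rewrite !iterSr /cheb2 real_normK ?num_real.
rewrite -[`|x|]invrK xu iter_cheb2_joukowski // normfV invrK gtr0_norm //.
by rewrite joukowski_gt0 // exprn_gt0.
Qed.

(** Write 1 / |p(0)| = joukowski u. Every iterate on [p] has the same preimage, so L (n 2^m) =
    joukowski (u^(2^m)) >= u^(2^m), whence u <= kappa^n. *)
Lemma preimage_equality n p : (0 < n)%N -> size p = n.+1 -> real_preimage p ->
  (forall x, `|p.[x]| <= 1 <-> A x) -> L n = joukowski (kappa ^+ n).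
Proof.
move=> n0 sp Hp pA; have p0 := preimage_norm_gt1 pA.
have LE := preimage_min_dev n0 sp Hp pA.
have [|u [u0 u1 uE]] := @joukowski_surj _ `|p.[0]|^-1.
  by rewrite invr_gt0 invf_lt1 ?p0 (lt_trans _ p0).
apply/eqP; rewrite eq_le min_dev_ge_joukowski // andbT LE -uE.
have /andP[k0 k1] := conv_factor_exp_itv n0.
apply: joukowski_mono; [exact: ltW| |exact: ltW].
apply: (lim_root_exp_ge min_dev_ge0 min_dev_le1 min_dev_submul n0 (ltW u0)) => m.
exists (2 ^ m)%N; first exact/ltnW/ltn_expl.
have um1 : u ^+ (2 ^ m) <= 1 by rewrite exprn_ile1 // ltW.
apply: le_trans (joukowski_ge _ um1) _; first by rewrite exprn_ge0 // ltW.
rewrite (@preimage_min_dev _ (iter m (@cheb2 _) p)).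
- by rewrite horner_iter_cheb2 (norm_iter_cheb2_joukowski m u0 (esym uE)).
- by rewrite muln_gt0 n0 expn_gt0.
- exact: size_iter_cheb2.
- exact: iter_cheb2_real_preimage.
- by move=> x; rewrite horner_iter_cheb2 norm_iter_cheb2_le1.
Qed.

End RealSet.

(** * The equality case *)

Section QuadraticFactor.
Variable R : realType.
Implicit Types (p d : {poly R}) (x y : R).

Local Notation toC p := (map_poly (real_complex R) p).

(** Stated with two complex roots to cover both a conjugate pair and two real roots; divisibility
    descends from the complex numbers. *)
Lemma quadratic_factor p d (z z' : R[i]) : p != 0 -> z != z' ->
  root (toC p) z -> root (toC p) z' -> toC d = ('X - z%:P) * ('X - z'%:P) ->
  exists2 g, p = g * d & (size g + 2)%N = size p.
Proof.
move=> p0 zz pz pz' dE.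
have dp : d %| p.
  rewrite -(dvdp_map (real_complex R)) dE.
  have := @uniq_roots_dvdp _ (toC p) [:: z; z'].
  rewrite !big_cons big_nil mulr1; apply; first by rewrite /= pz pz'.
  by rewrite uniq_rootsE /= inE zz.
have sd : size d = 3%N.
  rewrite -(size_map_poly (real_complex R)) dE size_mul ?polyXsubC_eq0 //.
  by rewrite !size_XsubC.
have /dvdpP[g pE] := dp; exists g => //.
have g0 : g != 0 by apply: contraNneq p0 => g0; rewrite pE g0 mul0r.
by rewrite pE size_mul -?size_poly_eq0 ?sd // ?size_poly_eq0 // addn3 addn2.
Qed.

Lemma root_toC_conj p (z : R[i]) : root (toC p) z -> root (toC p) (conjc z).
Proof.
suff E : map_poly conjc (toC p) = toC p by rewrite -complex_root_conj E.
by apply/polyP => i; rewrite !coef_map /= oppr0.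
Qed.

Lemma conj_factor x y :
  toC (('X - x%:P) ^+ 2 + (y ^+ 2)%:P) = ('X - (x +i* y)%:P) * ('X - (conjc (x +i* y))%:P).
Proof.
pose v := 'i%C * y%:C; have v2 : v * v = - (y ^+ 2)%:C.
  by rewrite /v mulrACA -expr2 sqr_i mulN1r -rmorphM.
have -> : conjc (x +i* y) = x%:C - v by rewrite /v; simpc.
have -> : x +i* y = x%:C + v by rewrite /v; simpc.
rewrite rmorphD rmorphXn rmorphB /= map_polyX !map_polyC /=.
rewrite -[(y ^+ 2)%:C]opprK -v2 polyCD polyCB polyCN polyCM; ring.
Qed.

Lemma real_factor x y :
  toC (('X - x%:P) * ('X - y%:P)) = ('X - x%:C%:P) * ('X - y%:C%:P).
Proof. by rewrite rmorphM !rmorphB /= map_polyX !map_polyC. Qed.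

End QuadraticFactor.

Section Equality.
Variables (R : realType) (A : set R) (B : R) (n : nat).
Hypothesis A_bnd : forall x, A x -> `|x| <= B.
Hypothesis Aseg : exists x y, x < y /\ (forall z, x <= z <= y -> A z).
Hypothesis Acl : closed A.
Hypothesis A00 : ~ A 0.
Hypothesis n0 : (0 < n)%N.
Implicit Types (p q : {poly R}) (x y u M : R) (j : nat).

Local Notation toC p := (map_poly (real_complex R) p).
Local Notation normc := ComplexField.Normc.normc.
Let S := real_complex R @` A.
Let kappa := conv_factor S.

Hypothesis LE : min_dev S n = joukowski (kappa ^+ n).

Variable q : {poly R}.
Hypotheses (sq : (size q <= n.+1)%N) (q0 : q.[0] = 1).
Hypothesis qL : forall x, A x -> `|q.[x]| <= min_dev S n.

Let p := (min_dev S n)^-1 *: q.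
Let F j := iter j (@cheb2 _) p.

Lemma conv_factor_exp_gt0 : 0 < kappa ^+ n.
Proof.
have L0 := min_dev_gt0 A_bnd Aseg n; have h : 0 < joukowski (kappa ^+ n) by rewrite -LE.
have /andP[k0 _] := conv_factor_exp_itv A_bnd Aseg Acl A00 n0.
rewrite lt_neqAle (k0 : 0 <= kappa ^+ n) andbT.
by apply: contraTneq h => <-; rewrite /joukowski mulr0 mul0r ltxx.
Qed.

Lemma iterate_norm j x : A x -> `|(F j).[x]| <= 1.
Proof.
move=> Ax; have L0 := min_dev_gt0 A_bnd Aseg n.
rewrite horner_iter_cheb2 norm_iter_cheb2_le1 hornerZ normrM normfV (gtr0_norm L0).
by rewrite ler_pdivrMl // mulr1 qL.
Qed.

Lemma iterate_horner0 j : (F j).[0] = (joukowski ((kappa ^+ n) ^+ (2 ^ j)))^-1.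
Proof.
by rewrite horner_iter_cheb2 hornerZ q0 mulr1 LE iter_cheb2_joukowski ?conv_factor_exp_gt0.
Qed.

Lemma iterate_horner0_gt0 j : 0 < (F j).[0].
Proof. by rewrite iterate_horner0 invr_gt0 joukowski_gt0 // exprn_gt0 ?conv_factor_exp_gt0. Qed.

Lemma iterate_size_le j : (size (F j) <= (n * 2 ^ j).+1)%N.
Proof. exact/size_iter_cheb2_le/(leq_trans (size_scale_leq _ _)). Qed.

(** By [LE], the reciprocal of the value of [F j] at 0 is exactly the lower bound in degree n 2^j;
    [smaller_norm_of_factor] would produce a deviation below it. *)
Lemma iterate_minimal j g (d : {poly R}) e : 0 < e -> (forall x, A x -> e <= d.[x]) ->
  F j = g * d -> ~~ (size g + 2 <= (n * 2 ^ j).+1)%N.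
Proof.
move=> e0 Ae FE; apply/negP => sg.
have [c c0 Ac] := sqr_away Acl A00.
have [|M MF /(min_dev_le_of_admissible A_bnd Aseg)] :=
  smaller_norm_of_factor (segment_nonempty Aseg) A_bnd c0 Ac e0 Ae
    FE (iterate_size_le j) sg _ (@iterate_norm j).
  by rewrite gt_eqF ?iterate_horner0_gt0.
rewrite leNgt => /negP; apply; apply: lt_le_trans MF _.
rewrite gtr0_norm ?iterate_horner0_gt0 // iterate_horner0 invrK -exprM.
by apply: (min_dev_ge_joukowski A_bnd Aseg Acl A00); rewrite muln_gt0 n0 expn_gt0.
Qed.

Lemma size_extremal : size p = n.+1.
Proof.
have sp : (size p <= n.+1)%N by exact: leq_trans (size_scale_leq _ _) _.
apply/eqP; rewrite eqn_leq sp /= ltnNge; apply/negP => spn.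
have sp' : (size p <= n.-1.+1)%N by rewrite prednK.
(* One iteration doubles the missing degree to at least two, the room that ['X^2] takes with
   [d = 1]. *)
suff sF : (size (F 1) + 2 <= (n * 2 ^ 1).+1)%N.
  have A1 x : A x -> 1 <= (1 : {poly R}).[x] by rewrite hornerC.
  by have := iterate_minimal ltr01 A1 (esym (mulr1 (F 1))); rewrite sF.
rewrite addn2 !ltnS; apply: leq_ltn_trans (size_iter_cheb2_le 1 sp') _.
by rewrite expn1 -[in ltnRHS](prednK n0) mulSn add2n.
Qed.

Lemma iterate_neq0 j : F j != 0.
Proof. by apply: contraTneq (iterate_horner0_gt0 j) => ->; rewrite hornerC ltxx. Qed.

Lemma iterate_no_factor j (d : {poly R}) (z z' : R[i]) e : 0 < e -> (forall x, A x -> e <= d.[x]) ->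
  z != z' -> root (toC (F j)) z -> root (toC (F j)) z' ->
  toC d <> ('X - z%:P) * ('X - z'%:P).
Proof.
move=> e0 Ae zz Fz Fz' dE; have [g FE sg] := quadratic_factor (iterate_neq0 j) zz Fz Fz' dE.
by have := iterate_minimal e0 Ae FE; rewrite sg iterate_size_le.
Qed.

(** A nonreal root x + i y and its conjugate give the factor (X - x)^2 + y^2, which is at least y^2
    > 0 on the real line. *)
Lemma iterate_real_roots j z : root (toC (F j)) z -> complex.Im z = 0.
Proof.
case: z => x y /= Fz; apply/eqP/negPn/negP => y0.
apply: (iterate_no_factor (e := y ^+ 2) _ _ _ Fz (root_toC_conj Fz) (conj_factor x y)).
- by rewrite exprn_even_gt0.
- by move=> t _; rewrite !hornerE lerDr sqr_ge0.
- by rewrite eq_complex /= eqxx /= -subr_eq0 opprK -mulr2n mulrn_eq0.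
Qed.

(** For [t] in [A], the differences [t - x] and [t - y] have the same sign and modulus at least
    [d / 2], so (X - x)(X - y) would be a forbidden positive factor. *)
Lemma iterate_gap_roots j x y c d : 0 < d -> (forall t, A t -> d <= `|t - c|) ->
  `|x - c| < d / 2 -> `|y - c| < d / 2 -> root (F j) x -> root (F j) y -> x = y.
Proof.
move=> d0 Ad xc yc Fx Fy; apply/eqP/negPn/negP => xy.
have root_toC t : root (F j) t -> root (toC (F j)) t%:C.
  by rewrite !rootE horner_map /= => /eqP ->.
apply: (iterate_no_factor (e := (d / 2) ^+ 2) _ _ _
  (root_toC _ Fx) (root_toC _ Fy) (real_factor x y)).
- by rewrite exprn_gt0 // divr_gt0.
- move=> t /Ad dt; rewrite !hornerE expr2.
  move: xc yc; rewrite !ltr_norml => /andP[x1 x2] /andP[y1 y2].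
  move: dt; rewrite ler_normr => /orP[] h.
    by apply: ler_pM; rewrite ?divr_ge0 ?(ltW d0) //; lra.
  rewrite -[leRHS]mulrNN.
  by apply: ler_pM; rewrite ?divr_ge0 ?(ltW d0) //; lra.
- by rewrite (inj_eq (@complexI R)).
Qed.

Lemma root_iterate j (z : R[i]) w : (toC p).[z] = w%:C ->
  iter j (@cheb2 _) w = 0 -> root (toC (F j)) z.
Proof.
move=> pz w0; rewrite rootE map_iter_cheb2 horner_iter_cheb2 pz.
suff -> : iter j (@cheb2 _) w%:C = (iter j (@cheb2 _) w)%:C by rewrite w0.
by elim: j {w0} => //= j ->; rewrite /cheb2 rmorphB rmorphMn rmorphXn rmorph1.
Qed.

Let sp1 : (1 < size p)%N. Proof. by rewrite size_extremal ltnS. Qed.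

(** Near a nonreal [z0] with p(z0) in [-1,1], [root_near] and density give a root of some iterate
    closer to [z0] than |Im z0|; being real, it cannot be that close. *)
Lemma extremal_real_preimage : real_preimage p.
Proof.
move=> z0 [w0 /= w01 /esym pz0]; apply/eqP/negPn/negP => y0.
have d0 : 0 < `|complex.Im z0| by rewrite normr_gt0.
have [e e0 He] := root_near sp1 pz0 d0.
have [j [w [_ [_ _ _ [/He[z pz zz0] _] [Fw _]]]]] := cheb2_zeros_dense w01 e0.
have Imz := iterate_real_roots (root_iterate pz Fw).
move: zz0; rewrite normc_distC ltNge => /negP; apply.
apply: le_trans (normIm_le_normc _).
by case: z0 z {pz0 y0 d0 He pz} Imz => [a b] [a' b'] /= ->; rewrite subr0.
Qed.

(** Around a point outside [A] with [|p.[x]| <= 1], two zeros of an iterate of T_2 near [p.[x]] pull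
    back to two real roots of [F j] in one gap. They differ because [p] takes different values
    there. *)
Lemma extremal_preimage x : `|p.[x]| <= 1 <-> A x.
Proof.
split=> [px|Ax]; last exact: (iterate_norm 0).
apply: contrapT => nAx.
have : nbhs x (~` A) by apply: open_nbhs_nbhs; split => //; exact: closed_openC.
move=> /nbhs_ballP[d /= d0 Hd].
have Ad t : A t -> d <= `|t - x|.
  by move=> At; rewrite leNgt distrC; apply/negP => td; exact: (Hd t).
have d2 : 0 < d / 2 by rewrite divr_gt0.
have pxC : (toC p).[x%:C] = p.[x]%:C by rewrite horner_map.
have [e e0 He] := root_near sp1 pxC d2.
have [|j [w [w' [_ _ ww' [/He[z pz zx] /He[z' pz' zx']] [Fw Fw']]]]] :=
  @cheb2_zeros_dense R p.[x] e _ e0; first by rewrite -ler_norml.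
have real_root u t : (toC p).[t] = u%:C -> iter j (@cheb2 _) u = 0 ->
    normc (t - x%:C) < d / 2 -> exists2 y, root (F j) y & `|y - x| < d / 2 /\ p.[y] = u.
  move=> pt Fu tx; have Ft := root_iterate pt Fu; have := iterate_real_roots Ft.
  case: t pt tx Ft => a b pt tx Ft /= b0; exists a.
    by move: Ft; rewrite b0 !rootE horner_map /= => /eqP[->].
  split; last by move: pt; rewrite b0 horner_map /= => -[].
  by have /= := le_lt_trans (normRe_le_normc _) tx.
have [y Fy [yx py]] := real_root _ _ pz Fw zx.
have [y' Fy' [yx' py']] := real_root _ _ pz' Fw' zx'.
move: ww'; rewrite -py -py' (iterate_gap_roots d0 Ad yx yx' Fy Fy') eqxx //.
Qed.

End Equality.

(** * Unions of intervals *)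

Section IntervalUnion.
Variables (R : realType) (l : nat) (a : l.*2.-tuple R).
Hypothesis hl : (0 < l)%N.
Hypothesis ha : sorted <%R a.

Definition real_union : set R := \bigcup_(i in `I_l) `[a`_i.*2, a`_i.*2.+1]%classic.

Lemma interval_unionE : interval_union a = real_complex R @` real_union.
Proof.
rewrite /interval_union /real_union; apply/seteqP; split.
  by move=> _ [i il [x xi <-]]; exists x => //; exists i.
by move=> _ [x [i il xi] <-]; exists i => //; exists x.
Qed.

Lemma real_union_closed : closed real_union.
Proof.
apply: closed_bigcup; first exact: finite_II.
by move=> i _; exact: itv_closed.
Qed.

Lemma real_union_bounded : exists B, forall x, real_union x -> `|x| <= B.
Proof.
exists (\sum_(i < l) (`|a`_i.*2| + `|a`_i.*2.+1|)) => x [i /= il].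
rewrite in_itv /= => /andP[h1 h2].
rewrite (bigD1 (Ordinal il)) //=; apply: ler_wpDr.
  by apply: sumr_ge0 => j _; rewrite addr_ge0.
have := ler_norm a`_i.*2.+1; have := ler_norm (- a`_i.*2); rewrite normrN.
have := normr_ge0 a`_i.*2.+1; have := normr_ge0 a`_i.*2.
by rewrite ler_norml; lra.
Qed.

Lemma real_union_segment :
  exists x y, x < y /\ (forall z, x <= z <= y -> real_union z).
Proof.
exists a`_0, a`_1; split; last by move=> z z01; exists 0%N.
have s2 : (1 < size a)%N by rewrite size_tuple; case: l hl.
case: (tval a) s2 ha => // x [//|y s] _ /=; by case/andP.
Qed.

End IntervalUnion.

(** * Convex hull of a real set and points on both sides of 0 *)

Section Hull.
Variables (R : realType) (A : set R).
Implicit Types s : R.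

Lemma convex_halfspace s :
  @convex_set R (Rcomplex R) [set z | 0 < s * complex.Re z].
Proof.
move=> x y t; rewrite !inE /= => hx hy.
have -> : s * complex.Re (conv t x y) =
    conv t (s * complex.Re x : R^o) (s * complex.Re y : R^o).
  by case: x y {hx hy} => [a b] [c d]; rewrite convRE /=; ring.
exact: convR_gt0.
Qed.

(** If [A] lay on one side of 0, an open half-plane would contain [A], hence its convex hull, but
    not 0. *)
Lemma hull_straddle : ~ A 0 -> convex_hull (real_complex R @` A) 0 ->
  exists s t, [/\ s < 0 < t, A s & A t].
Proof.
move=> A0 H.
have side s : ~ (forall x, A x -> 0 < s * x).
  move=> As; suff : 0 < s * complex.Re (0 : R[i]) by rewrite /= mulr0 ltxx.
  apply: (H [set z | 0 < s * complex.Re z]); split; first exact: convex_halfspace.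
  by move=> _ [x Ax <-] /=; exact: As.
have /existsNP[x /not_implyP[Ax /negP]] := side 1; rewrite mul1r -leNgt => x0.
have /existsNP[y /not_implyP[Ay /negP]] := side (-1).
rewrite mulN1r oppr_gt0 -leNgt => y0.
have nz z : A z -> z != 0 by move=> Az; apply/eqP => z0; apply: A0; rewrite -z0.
by exists x, y; split; rewrite // !lt_neqAle x0 y0 nz // eq_sym nz.
Qed.

End Hull.

(** * Passage between real and complex polynomials *)

Section Transfer.
Variables (R : realType) (A : set R).

Local Notation toC p := (map_poly (real_complex R) p).

Lemma inverse_imageE (p : {poly R}) : real_preimage p ->
  (forall x, `|p.[x]| <= 1 <-> A x) -> real_complex R @` A = inverse_image (toC p).
Proof.
move=> Hp pA; apply/seteqP; split => [_ [x /pA px <-]|z pz].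
  by exists p.[x]; [rewrite /= in_itv /= -ler_norml|rewrite horner_map].
have := Hp z pz; case: z pz => x y [c /=]; rewrite in_itv /= => c1 cp y0.
exists x; last by rewrite y0.
by apply/pA; move: cp; rewrite y0 horner_map ler_norml => -[<-].
Qed.

(** [P] takes real values on [A], so the polynomial of the imaginary parts of its coefficients
    vanishes on [A] and is zero. *)
Lemma real_of_inverse_image (P : {poly R[i]}) :
  (forall q : {poly R}, (forall x, A x -> q.[x] = 0) -> q = 0) ->
  real_complex R @` A = inverse_image P ->
  exists p, [/\ P = toC p, real_preimage p & forall x, `|p.[x]| <= 1 <-> A x].
Proof.
move=> A_inf AP.
have AE x : A x <-> inverse_image P x%:C.
  by rewrite -AP; split => [Ax|[y Ay [<-]]]; first by exists x.
have Im0 : poly_Im P = 0.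
  by apply: A_inf => x /AE[c _]; rewrite horner_ReIm => -[].
have PE : P = toC (poly_Re P).
  apply/polyP => i; rewrite coef_map coef_map_id0 //=.
  have := congr1 (fun q : {poly R} => q`_i) Im0; rewrite /= coef0 coef_map_id0 //.
  by case: P`_i => a b /= ->.
exists (poly_Re P); split => //.
  by move=> z; rewrite -PE -AP => -[x _ <-].
move=> x; split => [px|/AE[c]].
  apply/AE; rewrite PE; exists (poly_Re P).[x]; last by rewrite horner_map.
  by rewrite /= in_itv /= -ler_norml.
by rewrite /= in_itv /= -ler_norml horner_ReIm => c1 [<-].
Qed.

End Transfer.

Theorem theorem2 (R : realType) (n : nat) (hn : (0 < n)%N)
    (l : nat) (hl : (0 < l)%N)
    (a : l.*2.-tuple R) (ha : sorted <%R a)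
    (h0 : ~ interval_union a 0) :
  let S := interval_union a in
  let kappa := conv_factor S in
  [/\ 2 * kappa ^+ n / (1 + kappa ^+ (2 * n)) <= min_dev S n,
      min_dev S n = 2 * kappa ^+ n / (1 + kappa ^+ (2 * n)) <->
        exists P : {poly R[i]}, size P = n.+1 /\ S = inverse_image P
    & forall P : {poly R[i]},
        size P = n.+1 -> S = inverse_image P -> convex_hull S 0 ->
        min_dev S n = min_dev S n.+1].
Proof.
move=> S kappa.
have SE : S = real_complex R @` real_union a := interval_unionE a.
have [B A_bnd] := real_union_bounded a.
have Aseg := real_union_segment hl ha.
have Acl := @real_union_closed R l a.
have A0 : ~ real_union a 0 by move=> A0; apply: h0; rewrite interval_unionE; exists 0.
have jE : 2 * kappa ^+ n / (1 + kappa ^+ (2 * n)) = joukowski (kappa ^+ n).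
  by rewrite /joukowski -exprM mulnC.
have realP (P : {poly R[i]}) : size P = n.+1 -> S = inverse_image P ->
    exists p : {poly R}, [/\ size p = n.+1, real_preimage p &
      forall x, `|p.[x]| <= 1 <-> real_union a x].
  rewrite SE => sP /(real_of_inverse_image (poly_eq0_on_set Aseg))[p [PE Hp pA]].
  by exists p; split => //; rewrite -sP PE size_map_poly.
rewrite jE {jE}/kappa; split.
- by rewrite SE; exact: min_dev_ge_joukowski A_bnd Aseg Acl A0 n hn.
- split=> [|[P [sP /(realP P sP)[p [sp Hp pA]]]]]; last first.
    by rewrite SE; exact: preimage_equality A_bnd Aseg Acl A0 n p hn sp Hp pA.
  rewrite SE => LE; have [q [sq q0 qL]] := min_dev_attained n A_bnd Aseg.
  (* The witness is a minimizer of degree at most [n] divided by the minimum deviation. *)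
  exists (map_poly (real_complex R) ((min_dev (real_complex R @` real_union a) n)^-1 *: q)).
  split; first by rewrite size_map_poly (size_extremal A_bnd Aseg Acl A0 hn LE sq q0 qL).
  apply: inverse_imageE; first exact: (extremal_real_preimage A_bnd Aseg Acl A0 hn LE sq q0 qL).
  exact: (extremal_preimage A_bnd Aseg Acl A0 hn LE sq q0 qL).
- move=> P sP /(realP P sP)[p [sp Hp pA]]; rewrite SE => /(hull_straddle A0).
  exact: preimage_min_dev_succ A_bnd Aseg A0 n p hn sp Hp pA.
Qed.
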